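(* Let $n\ge1$ and let $\beta<n+2$ be fixed. Let $S\in\mathbb{R}$ and $\mathbf b\in\mathcal H^S(\mathbf T^n)$. For $\delta>0$ and $t\ge0$ let $\mathbf U^{\delta,\beta}(t)\in\mathcal H^{s'}(\mathbf T^n)$, $s'=S+\max\{0,\beta-n\}$, be the solution of the peridynamic equation $\frac{d^2}{dt^2}\mathbf U=\mathcal L^{\delta,\beta}\mathbf U+\mathbf b$, $\mathbf U(0)=0$, $\frac{d}{dt}\mathbf U(0)=0$, and let $\mathbf U^{\mathcal N}(t)\in\mathcal H^{s}(\mathbf T^n)$, $s=S+2$, be the solution of the Navier–Cauchy equation $\frac{d^2}{dt^2}\mathbf U^{\mathcal N}=\mathcal N\mathbf U^{\mathcal N}+\mathbf b$, $\mathbf U^{\mathcal N}(0)=0$, $\frac{d}{dt}\mathbf U^{\mathcal N}(0)=0$. Then for each $t\ge0$, $$\lim_{\delta\to0^+}\mathbf U^{\delta,\beta}(t)=\mathbf U^{\mathcal N}(t)\quad\text{in }\mathcal H^{s'}(\mathbf T^n).$$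
   Context: Torus and spaces: $\mathbf T^n=\prod_{i=1}^n[0,2\pi]$ with periodic identification; a periodic vector distribution $\mathbf g$ is written $\mathbf g=\sum_{k\in\mathbb{Z}^n}\widehat{\mathbf g}_k e^{ik\cdot x}$ with $\widehat{\mathbf g}_k\in\mathbb{C}^n$. For $q\in\mathbb{R}$, $\mathcal H^q(\mathbf T^n)$ is the space of periodic vector distributions with $\|\mathbf g\|^2_{\mathcal H^q}=\sum_k(1+\|k\|^2)^q\|\widehat{\mathbf g}_k\|^2<\infty$. Multipliers: with ${}_pF_q(a_1,\dots,a_p;b_1,\dots,b_q;x)=\sum_{m\ge0}\frac{(a_1)_m\cdots(a_p)_m}{(b_1)_m\cdots(b_q)_m}\frac{x^m}{m!}$, where $(a)_m=a(a+1)\cdots(a+m-1)$, set for $\nu\in\mathbb{R}^n$ $$\lambda_1(\nu)=-\|\nu\|^2\Big(3\mu\,{}_3F_4\big(1,\tfrac52,\tfrac{n+2-\beta}{2};2,\tfrac32,\tfrac{n+4}{2},\tfrac{n+4-\beta}{2};-\tfrac14\|\nu\|^2\delta^2\big)+(\lambda^*-\mu)\,{}_1F_2\big(\tfrac{n+2-\beta}{2};\tfrac{n+2}{2},\tfrac{n+4-\beta}{2};-\tfrac14\|\nu\|^2\delta^2\big)^2\Big),$$ $$\lambda_2(\nu)=-\mu\|\nu\|^2\,{}_2F_3\big(1,\tfrac{n+2-\beta}{2};2,\tfrac{n+4}{2},\tfrac{n+4-\beta}{2};-\tfrac14\|\nu\|^2\delta^2\big).$$ $M_k$ ($k\in\mathbb{Z}^n$)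 is the real symmetric $n\times n$ matrix with $M_kk=\lambda_1(k)k$, $M_kw=\lambda_2(k)w$ for $w\perp k$, and $M_0=0$; $M^{\mathcal N}_k=-(\lambda^*+\mu)k\otimes k-\mu\|k\|^2I$. The peridynamic and Navier operators act by $\mathcal L^{\delta,\beta}\mathbf u=\sum_kM_k\widehat{\mathbf u}_ke^{ik\cdot x}$ and $\mathcal N\mathbf u=\sum_kM_k^{\mathcal N}\widehat{\mathbf u}_ke^{ik\cdot x}$ (i.e. $\mathcal N\mathbf u=(\lambda^*+\mu)\nabla(\nabla\cdot\mathbf u)+\mu\Delta\mathbf u$). Solutions: the solutions are given explicitly by $$\mathbf U^{\delta,\beta}(t)=\widehat{\mathbf b}_0\frac{t^2}{2}+\sum_{0\ne k\in\mathbb{Z}^n}\left[\cos(\sqrt{-M_k}\,t)-I\right]M_k^{-1}\widehat{\mathbf b}_ke^{ik\cdot x},$$ and $\mathbf U^{\mathcal N}(t)$ by the same formula with $M_k$ replaced by $M_k^{\mathcal N}$; functions of symmetric matrices are defined by functional calculus on eigenvalues. Standing assumption: the Lamé parameters satisfy $\mu>0$, $\lambda^*+2\mu>0$ (so $-M_k^{\mathcal N}$ is positive definite for $k\ne0$), and are such that $\lambda_1(\nu)<0$ for all $\nu\ne0$ and all parameter values under consideration (and $\lambda_2(\nu)<0$ for all $\nu\ne0$). *)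

(* Defs.v *)
From HB Require Import structures.
From mathcomp Require Import all_boot all_order all_algebra.
From mathcomp Require Import complex.
From mathcomp Require Import all_classical all_reals all_analysis.
From mathcomp Require Import ring lra.

Set Implicit Arguments.
Unset Strict Implicit.
Unset Printing Implicit Defensive.

Import Order.TTheory GRing.Theory Num.Theory numFieldNormedType.Exports.
Local Open Scope classical_set_scope.
Local Open Scope ring_scope.
Local Open Scope complex_scope.

(* (a)_m = a (a + 1) ... (a + m - 1) *)
Definition pochhammer (R : realType) (a : R) (m : nat) : R :=
  \prod_(i < m) (a + i%:R).

(* Below p <= q and the b's are positive, so the series converges for all x. *)
Definition pFq (R : realType) (a b : seq R) (x : R) : R :=
  limn (series (fun m : nat =>
    (\prod_(c <- a) pochhammer c m) / (\prod_(c <- b) pochhammer c m)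
      * (x ^+ m / m`!%:R))).

(* The norm `|v| of the library on matrices is the sup norm, hence these
   Euclidean versions on R^n and C^n. *)
Definition sqnorm (R : realType) (n : nat) (v : 'cV[R]_n) : R :=
  \sum_(i < n) v i 0 ^+ 2.

Definition csqnorm (R : realType) (n : nat) (z : 'cV[R[i]]_n) : R :=
  \sum_(i < n) (complex.Re (z i 0) ^+ 2 + complex.Im (z i 0) ^+ 2).

Definition intvec (R : realType) (n : nat) (k : 'cV[int]_n) : 'cV[R]_n :=
  map_mx intr k.

(* A periodic vector distribution on the torus is represented by its family of
   Fourier coefficients. Finiteness of an H^q norm forces polynomial growth, so
   that every family in [Hspace q] is that of a distribution. *)
Definition fourier (R : realType) (n : nat) : Type :=
  'cV[int]_n -> 'cV[R[i]]_n.

Definition Hnorm (R : realType) (n : nat) (q : R) (g : fourier R n) : \bar R :=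
  sqrte (\esum_(k in [set: 'cV[int]_n])
           ((1 + sqnorm (intvec R k)) `^ q * csqnorm (g k))%:E).

Definition Hspace (R : realType) (n : nat) (q : R) : set (fourier R n) :=
  [set g | (Hnorm q g < +oo)%E].

Definition lambda1 (R : realType) (n : nat) (mu lam delta beta : R)
    (nu : 'cV[R]_n) : R :=
  let N : R := n%:R in
  let x := - (sqnorm nu * delta ^+ 2) / 4 in
  - sqnorm nu *
    (3 * mu * pFq [:: 1; 5 / 2; (N + 2 - beta) / 2]
                  [:: 2; 3 / 2; (N + 4) / 2; (N + 4 - beta) / 2] x
     + (lam - mu) * pFq [:: (N + 2 - beta) / 2]
                        [:: (N + 2) / 2; (N + 4 - beta) / 2] x ^+ 2).

Definition lambda2 (R : realType) (n : nat) (mu delta beta : R)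
    (nu : 'cV[R]_n) : R :=
  let N : R := n%:R in
  let x := - (sqnorm nu * delta ^+ 2) / 4 in
  - mu * sqnorm nu *
    pFq [:: 1; (N + 2 - beta) / 2]
        [:: 2; (N + 4) / 2; (N + 4 - beta) / 2] x.

(* Orthogonal projector onto the line spanned by v (0 when v = 0). *)
Definition line_proj (R : realType) (n : nat) (v : 'cV[R]_n) : 'M[R]_n :=
  (sqnorm v)^-1 *: (v *m v^T).

(* The symmetric matrix with eigenvalue a on the line spanned by v and c on its
   orthogonal complement. *)
Definition line_perp_mx (R : realType) (n : nat) (v : 'cV[R]_n) (a c : R) :
    'M[R]_n :=
  a *: line_proj v + c *: (1%:M - line_proj v).

Definition perimx (R : realType) (n : nat) (mu lam delta beta : R)
    (k : 'cV[int]_n) : 'M[R]_n :=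
  if k == 0 then 0
  else line_perp_mx (intvec R k)
         (lambda1 mu lam delta beta (intvec R k))
         (lambda2 mu delta beta (intvec R k)).

Definition naviermx (R : realType) (n : nat) (mu lam : R) (k : 'cV[int]_n) :
    'M[R]_n :=
  - (lam + mu) *: (intvec R k *m (intvec R k)^T)
  - (mu * sqnorm (intvec R k))%:M.

(* u |-> sum_k M_k u_k e^{i k.x} *)
Definition multiplier (R : realType) (n : nat) (M : 'cV[int]_n -> 'M[R]_n)
    (u : fourier R n) : fourier R n :=
  fun k => map_mx (real_complex R) (M k) *m u k.

(* V is the time derivative of U on [0, +oo) (one-sided at 0), in the sense of
   distributions in x, i.e., for each Fourier coefficient. *)
Definition time_derivative (R : realType) (n : nat) (U V : R -> fourier R n) :
    Prop :=
  forall (k : 'cV[int]_n) (t : R), 0 <= t ->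
    csqnorm (((s - t)^-1)%:C *: (U s k - U t k) - V t k)
      @[s --> within [set s : R | 0 <= s] t^'] --> (0 : R).

(* U'' = L U + b on [0, +oo), U(0) = 0, U'(0) = 0, where L is the multiplier
   operator with symbol M. *)
Definition cauchy_solution (R : realType) (n : nat)
    (M : 'cV[int]_n -> 'M[R]_n) (b : fourier R n) (U : R -> fourier R n) :
    Prop :=
  exists V : R -> fourier R n,
    [/\ time_derivative U V,
        time_derivative V (fun t => multiplier M (U t) \+ b),
        U 0 = (fun=> 0) & V 0 = (fun=> 0)].

(* The explicit solution: (cos (sqrt (- M_k) t) - I) M_k^-1 b_k by functional
   calculus on the eigenvalues l1 k (along k) and l2 k (orthogonally to k) of
   M_k, and t^2/2 b_0 for k = 0. *)
Definition explicit_solution (R : realType) (n : nat)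
    (l1 l2 : 'cV[int]_n -> R) (b : fourier R n) (t : R) : fourier R n :=
  let phi (l : R) := (cos (Num.sqrt (- l) * t) - 1) / l in
  fun k =>
    if k == 0 then (t ^+ 2 / 2)%:C *: b 0
    else map_mx (real_complex R)
           (line_perp_mx (intvec R k) (phi (l1 k)) (phi (l2 k))) *m b k.

Lemma sqnorm_eq0 (R : realType) (n : nat) (v : 'cV[R]_n) :
  (sqnorm v == 0) = (v == 0).
Proof.
apply/idP/eqP => [|->]; last first.
  by rewrite /sqnorm big1// => i _; rewrite mxE expr0n.
rewrite /sqnorm psumr_eq0 => [/allP h|i _]; last exact: sqr_ge0.
apply/matrixP => i j; rewrite (ord1 j) mxE; apply/eqP.
by have := h i (mem_index_enum _); rewrite /= sqrf_eq0.
Qed.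

Lemma sqnormE (R : realType) (n : nat) (v : 'cV[R]_n) :
  v^T *m v = (sqnorm v)%:M.
Proof.
apply/matrixP => i j; rewrite !ord1 !mxE /sqnorm eqxx mulr1n.
by apply: eq_bigr => l _; rewrite mxE -expr2.
Qed.

Lemma intvec_eq0 (R : realType) (n : nat) (k : 'cV[int]_n) :
  (intvec R k == 0) = (k == 0).
Proof.
apply/eqP/eqP => [h|->]; last by apply/matrixP => i j; rewrite !mxE.
apply/matrixP => i j; move/matrixP/(_ i j): h; rewrite !mxE => /eqP.
by rewrite intr_eq0 => /eqP.
Qed.

Lemma line_proj_self (R : realType) (n : nat) (v : 'cV[R]_n) :
  line_proj v *m v = v.
Proof.
have [->|v0] := eqVneq v 0; first by rewrite mulmx0.
rewrite /line_proj -scalemxAl -mulmxA sqnormE mul_mx_scalar scalerA mulVf.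
  by rewrite scale1r.
by rewrite sqnorm_eq0.
Qed.

Lemma line_proj_perp (R : realType) (n : nat) (v w : 'cV[R]_n) :
  v^T *m w = 0 -> line_proj v *m w = 0.
Proof. by move=> h; rewrite /line_proj -scalemxAl -mulmxA h mulmx0 scaler0. Qed.

Lemma line_proj_idem (R : realType) (n : nat) (v : 'cV[R]_n) :
  line_proj v *m line_proj v = line_proj v.
Proof.
by rewrite {2}/line_proj -scalemxAr mulmxA line_proj_self.
Qed.

Lemma line_perp_mxM (R : realType) (n : nat) (v : 'cV[R]_n) (a c a' c' : R) :
  line_perp_mx v a c *m line_perp_mx v a' c' = line_perp_mx v (a * a') (c * c').
Proof.
have e0 := line_proj_idem v.
have e1 : line_proj v *m (1%:M - line_proj v) = 0.
  by rewrite mulmxBr mulmx1 line_proj_idem subrr.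
have e2 : (1%:M - line_proj v) *m line_proj v = 0.
  by rewrite mulmxBl mul1mx line_proj_idem subrr.
have e3 : (1%:M - line_proj v) *m (1%:M - line_proj v) = 1%:M - line_proj v.
  by rewrite mulmxBr mulmx1 e2 subr0.
rewrite /line_perp_mx; move: (1%:M - _) e1 e2 e3 => Q.
move: (line_proj v) e0 => P e0 e1 e2 e3.
rewrite mulmxDl !mulmxDr -!scalemxAl -!scalemxAr.
by rewrite e0 e1 e2 e3 !scaler0 addr0 add0r !scalerA.
Qed.

Lemma line_perp_mxD (R : realType) (n : nat) (v : 'cV[R]_n) (a c a' c' : R) :
  line_perp_mx v a c + line_perp_mx v a' c' = line_perp_mx v (a + a') (c + c').
Proof. by rewrite /line_perp_mx !scalerDl addrACA. Qed.

Lemma line_perp_mx1 (R : realType) (n : nat) (v : 'cV[R]_n) :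
  line_perp_mx v 1 1 = 1%:M.
Proof. by rewrite /line_perp_mx !scale1r addrC subrK. Qed.

Lemma perimx_sym (R : realType) (n : nat) (mu lam delta beta : R)
    (k : 'cV[int]_n) :
  (perimx mu lam delta beta k)^T = perimx mu lam delta beta k.
Proof.
rewrite /perimx; case: ifP => _; first by rewrite trmx0.
have tP : (line_proj (intvec R k))^T = line_proj (intvec R k).
  by rewrite /line_proj linearZ/= trmx_mul trmxK.
rewrite /line_perp_mx; move: (line_proj _) tP => P tP.
by rewrite raddfD/= !linearZ/= raddfB/= trmx1 tP.
Qed.

Lemma perimx_self (R : realType) (n : nat) (mu lam delta beta : R)
    (k : 'cV[int]_n) :
  perimx mu lam delta beta k *m intvec R k
    = lambda1 mu lam delta beta (intvec R k) *: intvec R k.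
Proof.
rewrite /perimx; case: ifPn => [|_].
  by rewrite -(intvec_eq0 R) => /eqP ->; rewrite mul0mx scaler0.
have := line_proj_self (intvec R k).
rewrite /line_perp_mx; move: (line_proj _) => P Pk.
by rewrite mulmxDl -!scalemxAl mulmxBl mul1mx Pk subrr scaler0 addr0.
Qed.

Lemma perimx_perp (R : realType) (n : nat) (mu lam delta beta : R)
    (k : 'cV[int]_n) (w : 'cV[R]_n) :
  (intvec R k)^T *m w = 0 ->
  perimx mu lam delta beta k *m w = lambda2 mu delta beta (intvec R k) *: w.
Proof.
move=> kw; rewrite /perimx; case: ifPn => [|_].
  rewrite -(intvec_eq0 R) -sqnorm_eq0 /lambda2 => /eqP ->.
  by rewrite mulr0 mul0r scale0r mul0mx.
have := line_proj_perp kw.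
rewrite /line_perp_mx; move: (line_proj _) => P Pk.
by rewrite mulmxDl -!scalemxAl mulmxBl mul1mx Pk subr0 scaler0 add0r.
Qed.

Lemma naviermxE (R : realType) (n : nat) (mu lam : R) (k : 'cV[int]_n) :
  naviermx mu lam k =
  line_perp_mx (intvec R k) (- (lam + 2 * mu) * sqnorm (intvec R k))
                            (- mu * sqnorm (intvec R k)).
Proof.
rewrite /naviermx /line_perp_mx.
have -> : intvec R k *m (intvec R k)^T
          = sqnorm (intvec R k) *: line_proj (intvec R k).
  have [k0|k0] := eqVneq (intvec R k) 0.
    by rewrite /line_proj k0 !mul0mx !scaler0.
  by rewrite /line_proj scalerA mulfV ?scale1r// sqnorm_eq0.
set P := line_proj _; set N := sqnorm _.
by apply/matrixP => i j; rewrite !mxE; ring.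
Qed.

Lemma csqnorm_cvg0 (R : realType) (n : nat) (F : set_system R) (f g : R -> R)
    (x y : 'cV[R[i]]_n) : Filter F ->
  f s @[s --> F] --> (0 : R) -> g s @[s --> F] --> (0 : R) ->
  csqnorm ((f s)%:C *: x + (g s)%:C *: y) @[s --> F] --> (0 : R).
Proof.
move=> FF f0 g0.
have E s : csqnorm ((f s)%:C *: x + (g s)%:C *: y) =
  \sum_(i < n) ((f s * complex.Re (x i 0) + g s * complex.Re (y i 0)) ^+ 2
              + (f s * complex.Im (x i 0) + g s * complex.Im (y i 0)) ^+ 2).
  rewrite /csqnorm; apply: eq_bigr => i _; rewrite !mxE.
  case: (x i 0) => xr xi; case: (y i 0) => yr yi /=.
  by rewrite !mul0r !subr0 !addr0.
under eq_fun do rewrite E.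
have E0 : nbhs (0 : R) = nbhs (\sum_(i < n)
   ((0 * complex.Re (x i 0) + 0 * complex.Re (y i 0)) ^+ 2
              + (0 * complex.Im (x i 0) + 0 * complex.Im (y i 0)) ^+ 2)).
  by rewrite big1// => i _; rewrite !mul0r !addr0 expr0n /= addr0.
rewrite E0; apply: (@cvg_big R _ +%R 0 xpredT) => [|i _].
  exact: add_continuous.
by apply: cvgD; rewrite !expr2; apply: cvgM; apply: cvgD;
  apply: cvgM => //; apply: cvg_cst.
Qed.

Lemma time_derivative_pair (R : realType) (n : nat) (U V : R -> fourier R n) :
  (forall k, exists (f f' g g' : R -> R) (x y : 'cV[R[i]]_n),
    [/\ forall t, is_derive t (1 : R) f (f' t),
        forall t, is_derive t (1 : R) g (g' t),
        forall t, U t k = (f t)%:C *: x + (g t)%:C *: y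
      & forall t, V t k = (f' t)%:C *: x + (g' t)%:C *: y]) ->
  time_derivative U V.
Proof.
have quot (f : R -> R) (t d : R) : is_derive t (1 : R) f d ->
    (s - t)^-1 * (f s - f t) - d @[s --> t^'] --> (0 : R).
  move=> [df <-]; rewrite -(subrr ('D_1 f t)).
  apply: cvgB; last exact: cvg_cst.
  have st : s - t @[s --> t^'] --> (0 : R)^'.
    move=> A; rewrite /dnbhs /within /= => /nbhs_ballP[r r0 hr].
    apply/nbhs_ballP; exists r => //= s ts nst.
    apply: hr; last by rewrite subr_eq0.
    by move: ts; rewrite /ball/= sub0r normrN distrC.
  have := cvg_comp _ _ st df; apply: cvg_trans; apply: near_eq_cvg.
  by near=> s; rewrite /= scaler1 subrK.
move=> H k t t0; have [f [f' [g [g' [x [y [df dg UE VE]]]]]]] := H k.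
have E s : ((s - t)^-1)%:C *: (U s k - U t k) - V t k =
  ((s - t)^-1 * (f s - f t) - f' t)%:C *: x +
  ((s - t)^-1 * (g s - g t) - g' t)%:C *: y.
  rewrite !UE VE; apply/matrixP => i j; rewrite !mxE.
  by rewrite !(rmorphB, rmorphM) /=; ring.
under eq_fun do rewrite E.
apply: csqnorm_cvg0.
- by apply: cvg_trans (quot _ _ _ (df t)); apply: cvg_app; exact: cvg_within.
- by apply: cvg_trans (quot _ _ _ (dg t)); apply: cvg_app; exact: cvg_within.
Unshelve. all: by end_near. Qed.

Lemma explicit_solutionP (R : realType) (n : nat) (M : 'cV[int]_n -> 'M[R]_n)
    (l1 l2 : 'cV[int]_n -> R) (b : fourier R n) :
  M 0 = 0 ->
  (forall k, k != 0 -> M k = line_perp_mx (intvec R k) (l1 k) (l2 k)) ->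
  (forall k, k != 0 -> l1 k < 0) -> (forall k, k != 0 -> l2 k < 0) ->
  cauchy_solution M b (explicit_solution l1 l2 b).
Proof.
move=> M0 Mk l1N l2N.
pose phi (l t : R) := (cos (Num.sqrt (- l) * t) - 1) / l.
pose psi (l t : R) := sin (Num.sqrt (- l) * t) / Num.sqrt (- l).
pose C (A : 'M[R]_n) := map_mx (real_complex R) A.
pose P k := C (line_proj (intvec R k)).
pose Q k := C (1%:M - line_proj (intvec R k)).
have CE k a c : C (line_perp_mx (intvec R k) a c) *m b k
    = a%:C *: (P k *m b k) + c%:C *: (Q k *m b k).
  rewrite /P /Q /line_perp_mx; move: (line_proj _) (1%:M - _) => A B.
  by rewrite /C map_mxD !map_mxZ mulmxDl -!scalemxAl.
have dphi l t : l < 0 -> is_derive t (1 : R) (phi l) (psi l t).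
  move=> l0; have r0 : Num.sqrt (- l) != 0 by rewrite gt_eqF// sqrtr_gt0 oppr_gt0.
  have lE : l = - Num.sqrt (- l) ^+ 2 by rewrite sqr_sqrtr ?opprK// oppr_ge0 ltW.
  rewrite /phi /psi; move: (Num.sqrt _) r0 lE => w w0 ->.
  have dw : is_derive t (1 : R) (fun t => w * t) w.
    by apply: is_derive_eq; rewrite /GRing.scale /= mulr1.
  have dc : is_derive t (1 : R) (fun t => cos (w * t)) (- sin (w * t) * w).
    by apply: is_derive_eq; rewrite /GRing.scale /= mulrC.
  apply: is_derive_eq.
  rewrite scaler0 add0r subr0.
  have -> : forall a c : R, a *: c = a * c by [].
  by field.
have dpsi l t : l < 0 -> is_derive t (1 : R) (psi l) (cos (Num.sqrt (- l) * t)).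
  move=> l0; have r0 : Num.sqrt (- l) != 0 by rewrite gt_eqF// sqrtr_gt0 oppr_gt0.
  rewrite /psi; move: (Num.sqrt _) r0 => w w0.
  have dw : is_derive t (1 : R) (fun t => w * t) w.
    by apply: is_derive_eq; rewrite /GRing.scale /= mulr1.
  apply: is_derive_eq.
  rewrite scaler0 add0r.
  have -> : forall a c : R, a *: c = a * c by [].
  by field.
exists (fun t k => if k == 0 then t%:C *: b 0
  else (psi (l1 k) t)%:C *: (P k *m b k) + (psi (l2 k) t)%:C *: (Q k *m b k)).
split.
- apply: time_derivative_pair => k; rewrite /explicit_solution.
  case: (eqVneq k 0) => [k0|k0].
    exists (fun t => t ^+ 2 / 2), (fun t => t), (fun=> 0), (fun=> 0), (b 0), 0.
    split=> // t; rewrite ?scaler0 ?addr0//.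
      by apply: is_derive_eq; rewrite /GRing.scale /=; field.
    exact: is_derive_cst.
  exists (phi (l1 k)), (psi (l1 k)), (phi (l2 k)), (psi (l2 k)),
    (P k *m b k), (Q k *m b k); split=> // t.
  + by apply: dphi; apply: l1N.
  + by apply: dphi; apply: l2N.
- apply: time_derivative_pair => k; rewrite /explicit_solution /multiplier /=.
  case: (eqVneq k 0) => [k0|k0].
    exists (fun t => t), (fun=> 1), (fun=> 0), (fun=> 0), (b 0), 0.
    split=> // t; rewrite ?scaler0 ?addr0//.
    - exact: is_derive_id.
    - exact: is_derive_cst.
    by rewrite k0 M0 map_mx0 mul0mx add0r scale1r.
  exists (psi (l1 k)), (fun t => cos (Num.sqrt (- l1 k) * t)),
    (psi (l2 k)), (fun t => cos (Num.sqrt (- l2 k) * t)),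
    (P k *m b k), (Q k *m b k); split=> // t.
  + by apply: dpsi; apply: l1N.
  + by apply: dpsi; apply: l2N.
  + rewrite Mk// mulmxA -map_mxM line_perp_mxM -[X in _ + X]mul1mx.
    rewrite -(map_mx1 (real_complex R)) -(line_perp_mx1 (intvec R k)).
    rewrite -mulmxDl -map_mxD line_perp_mxD CE.
    by rewrite ![_ * (_ / _)]mulrC !divfK ?subrK// lt_eqF ?l1N ?l2N.
- apply/funext => k; rewrite /explicit_solution.
  case: ifP => _; first by rewrite expr0n /= mul0r scale0r.
  by rewrite CE !mulr0 cos0 subrr !mul0r !scale0r addr0.
- apply/funext => k; case: ifP => _; first by rewrite scale0r.
  by rewrite /psi !mulr0 sin0 !mul0r !scale0r addr0.
Qed.

(* Main.v *)
Require Import Defs.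
From HB Require Import structures.
From mathcomp Require Import all_boot all_order all_algebra.
From mathcomp Require Import complex.
From mathcomp Require Import all_classical all_reals all_analysis.
From mathcomp Require Import ring lra.

Set Implicit Arguments.
Unset Strict Implicit.
Unset Printing Implicit Defensive.

Import Order.TTheory GRing.Theory Num.Theory numFieldNormedType.Exports.
Local Open Scope classical_set_scope.
Local Open Scope ring_scope.

(** Mode by mode, both problems are systems of uncoupled oscillators, so that
    the solutions are the explicit ones ([cauchy_solution_unique]): on an
    eigenspace of eigenvalue [l < 0] the data are multiplied by [(cos (sqrt (-
    l) t) - 1) / l] ([time_factor]). As the horizon vanishes each eigenvalue
    tends to that of the Navier operator, since a hypergeometric series is
    continuous with value 1 at 0, and hence so does each factor. The limit in
    the Sobolev norm is then dominated convergence for a sum over the lattice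
    ([Hnorm_dominated_cvg0]); what remains is to bound [(1 + |k| ^ 2) ^ max(0,
    beta - n)] times the squared factor uniformly in small [delta] and in [k].

    If [beta <= n] the bound [t ^ 2 / 2] on the factor is enough. If [n < beta
    < n + 2], the factor is at most [2 / |l|], and it suffices that [|l| >= K
    |k| ^ (beta - n)], which is a matter of the behaviour of the hypergeometric
    functions at infinity. Put [a = (n + 2 - beta) / 2], which lies in ]0, 1[,
    and [w = |k| ^ 2 delta ^ 2 / 4]; the claim becomes that the profiles [- l /
    |k| ^ 2], as functions of [w], are at least [K (1 + w) ^ (- a)]. On a
    compact interval this is the assumed negativity of the eigenvalues, so only
    large [w] matter.

    There monotonicity replaces asymptotic expansions. A pair of parameters [a;
    a + 1] in a hypergeometric series means the weighted average [F(w) = a *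
    \int_0^1 s ^ (a - 1) * f(s w) ds] of the series [f] without that pair, so
    that [w ^ a F(w)] has derivative [a w ^ (a - 1) f(w)]. For the second
    multiplier [f] is [(1 - J(w)) / w] up to a positive factor, where [J] is a
    normalised Bessel function; an energy estimate for Bessel's equation gives
    [|J| <= 1] ([bessel_energy]), hence [f >= 0], and [w ^ a F(w)] is
    nondecreasing ([avg_lower]). The 3F4 series of the first multiplier is a
    combination of the same [F] and [f] with nonnegative weights ([pFq_3F4]).
    Its 1F2 series is the average of a Bessel function, which the same energy
    estimate bounds by a multiple of [w ^ (- 1 / 2)] ([bessel_decay]); this
    makes its square negligible before [w ^ (- a)], whatever the sign of its
    coefficient ([bessel_avg_decay], [profile1_growth]). *)

(** * Entire power series *)

(** A class of entire power series that is stable under formal differentiation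
    and under the Euler operator. *)
Definition fact_bounded (R : realType) (f : nat -> R) :=
  exists (K : R) (A : nat), forall m, `|f m| <= K * (A%:R ^+ m / m`!%:R).

Definition psum (R : realType) (f : nat -> R) (x : R) : R :=
  limn (pseries f x).

Lemma fact_bounded_diffs (R : realType) (f : nat -> R) :
  fact_bounded f -> fact_bounded (pseries_diffs f).
Proof.
move=> [K [A fK]]; exists (K * A%:R), A => m.
rewrite /pseries_diffs normrM ger0_norm// -ler_pdivlMl//.
apply: le_trans (fK m.+1) _; rewrite factS natrM invfM exprS.
by rewrite le_eqVlt; apply/orP; left; apply/eqP; ring.
Qed.

Lemma fact_bounded_le (R : realType) (f g : nat -> R) :
  (forall m, `|f m| <= `|g m|) -> fact_bounded g -> fact_bounded f.
Proof.
move=> fg [K [A gK]]; exists K, A => m; exact: le_trans (fg m) (gK m).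
Qed.

Lemma fact_bounded_euler (R : realType) (f : nat -> R) :
  fact_bounded f -> fact_bounded (fun m => m%:R * f m).
Proof.
move=> [K [A fK]]; exists K, (2 * A)%N => m.
rewrite normrM ger0_norm// natrM exprMn -mulrA mulrCA ler_pM//.
by rewrite -natrX ler_nat ltnW// ltn_expl.
Qed.

Lemma psum_is_cvg (R : realType) (f : nat -> R) (x : R) :
  fact_bounded f -> cvgn (pseries f x).
Proof.
move=> [K [A fK]]; apply: normed_cvg.
apply: (@series_le_cvg _ _ (K *: exp_coeff (A%:R * `|x|))) => [m|m|m|].
- exact: normr_ge0.
- rewrite /GRing.scale/= mulr_ge0 ?exp_coeff_ge0// ?mulr_ge0//.
  by have := le_trans (normr_ge0 _) (fK 0); rewrite expr0 divr1 mulr1.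
- rewrite /GRing.scale/= normrM normrX /exp_coeff/= exprMn.
  rewrite [leRHS](_ : _ = K * (A%:R ^+ m / m`!%:R) * `|x| ^+ m).
    by rewrite ler_wpM2r// exprn_ge0.
  by rewrite /GRing.scale/=; ring.
- exact: is_cvg_seriesZ (is_cvg_series_exp_coeff _).
Qed.

Lemma psum_lin (R : realType) (f g : nat -> R) (a b x : R) :
  fact_bounded f -> fact_bounded g ->
  psum (fun m => a * f m + b * g m) x = a * psum f x + b * psum g x.
Proof.
move=> hf hg; have cf := psum_is_cvg (x := x) hf.
have cg := psum_is_cvg (x := x) hg.
rewrite /psum /pseries.
have -> : (fun m => (a * f m + b * g m) * x ^+ m) =
  a *: (fun m => f m * x ^+ m) + b *: (fun m => g m * x ^+ m).
  by apply/funext => m; rewrite !fctE/= /GRing.scale/=; ring.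
rewrite (lim_seriesD (is_cvg_seriesZ (k := a) cf) (is_cvg_seriesZ (k := b) cg)).
by rewrite (lim_seriesZ a cf) (lim_seriesZ b cg).
Qed.

Lemma psum_recl (R : realType) (f : nat -> R) (x : R) :
  fact_bounded (fun m => f m.+1) ->
  psum f x = f 0 + x * psum (fun m => f m.+1) x.
Proof.
move=> hg; have cg := psum_is_cvg (x := x) hg.
apply/cvg_lim => //; rewrite -(cvg_shiftS (pseries f x)).
have -> : (fun n => pseries f x n.+1) =
   (fun n => f 0 + x * pseries (fun m => f m.+1) x n).
  apply/funext => m; rewrite /pseries !seriesEord/= big_ord_recl/= expr0 mulr1.
  congr (_ + _); rewrite mulr_sumr; apply: eq_bigr => i _.
  by rewrite exprS mulrCA.
by apply: cvgD; [exact: cvg_cst|apply: cvgM => //; exact: cvg_cst].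
Qed.

Lemma fact_boundedS (R : realType) (f : nat -> R) :
  fact_bounded f -> fact_bounded (fun m => f m.+1).
Proof.
move=> hf; apply: fact_bounded_le (fact_bounded_diffs hf) => m.
by rewrite /pseries_diffs normrM ler_peMl// ger0_norm// ler1n.
Qed.

Lemma psum0 (R : realType) (f : nat -> R) : fact_bounded f -> psum f 0 = f 0.
Proof.
by move=> hf; rewrite psum_recl ?mul0r ?addr0//; exact: fact_boundedS.
Qed.

Lemma is_derive_psum (R : realType) (f : nat -> R) (x : R) : fact_bounded f ->
  is_derive x (1 : R) (psum f) (psum (pseries_diffs f) x).
Proof.
move=> hf; have hf1 := fact_bounded_diffs hf.
apply: (@pseries_snd_diffs _ f (`|x| + 1)); try exact: psum_is_cvg.
  exact: psum_is_cvg (fact_bounded_diffs hf1).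
by rewrite [ltRHS]ger0_norm ?ltrDl// addr_ge0.
Qed.

Lemma continuous_psum (R : realType) (f : nat -> R) :
  fact_bounded f -> continuous (psum f).
Proof.
move=> hf x; apply/differentiable_continuous/derivable1_diffP.
by have [] := is_derive_psum x hf.
Qed.

(** The Euler operator [x d/dx] acts diagonally on coefficients, which turns
    hypergeometric recurrences into differential equations. *)
Lemma psum_euler (R : realType) (f : nat -> R) (x : R) : fact_bounded f ->
  x * psum (pseries_diffs f) x = psum (fun m => m%:R * f m) x.
Proof.
move=> hf; rewrite [RHS]psum_recl ?mul0r ?add0r//.
exact: fact_bounded_diffs.
Qed.

(** * Bessel functions *)

Lemma nondecreasing_ray (R : realType) (f df : R -> R) (a b : R) :
  a <= b -> (forall x, a <= x -> is_derive x (1 : R) f (df x)) ->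
  (forall x, a <= x -> 0 <= df x) -> f a <= f b.
Proof.
move=> ab dfP df0; rewrite -subr_ge0.
have [||c] := MVT_segment ab (f := f) (df := df).
- by move=> x; rewrite in_itv/= => /andP[/ltW ax _]; exact: dfP.
- apply: derivable_within_continuous => x; rewrite in_itv/= => /andP[ax _].
  by have [] := dfP x ax.
- rewrite in_itv/= => /andP[ac _] ->.
  by rewrite mulr_ge0 ?df0// subr_ge0.
Qed.

Lemma pochhammerS (R : realType) (a : R) (m : nat) :
  pochhammer a m.+1 = pochhammer a m * (a + m%:R).
Proof. by rewrite /pochhammer big_ord_recr. Qed.

Lemma pochhammerSl (R : realType) (a : R) (m : nat) :
  pochhammer a m.+1 = a * pochhammer (a + 1) m.
Proof.
rewrite /pochhammer big_ord_recl addr0; congr (_ * _); apply: eq_bigr => i _.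
by rewrite /= /bump/= natrD addrA.
Qed.

Lemma pochhammer_gt0 (R : realType) (a : R) (m : nat) :
  0 < a -> 0 < pochhammer a m.
Proof. by move=> a0; apply: prodr_gt0 => i _; rewrite ltr_wpDr. Qed.

Lemma pochhammer1 (R : realType) (m : nat) : pochhammer (1 : R) m = m`!%:R.
Proof.
elim: m => [|m IH]; first by rewrite /pochhammer big_ord0.
by rewrite pochhammerS IH factS mulnC natrM -natr1 addrC.
Qed.

Lemma pochhammer2 (R : realType) (m : nat) :
  pochhammer (2 : R) m = (m.+1)`!%:R.
Proof. by rewrite -pochhammer1 pochhammerSl mul1r. Qed.

(** The coefficients of the series 0F1(; c; x), a normalised Bessel function:
    for [c = d / 2 + 1], its value at [- r ^ 2 / 4] is the average of the plane
    wave of frequency [r] over the unit ball of dimension [d]. *)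
Definition bessel (R : realType) (c : R) (m : nat) : R :=
  (pochhammer c m * m`!%:R)^-1.

Lemma bessel0 (R : realType) (c : R) : bessel c 0 = 1.
Proof. by rewrite /bessel /pochhammer big_ord0 mulr1 invr1. Qed.

Lemma pochhammer_bounded (R : realType) (c : R) (f : nat -> R) :
  0 < c -> fact_bounded f -> fact_bounded (fun m => f m / pochhammer c m).
Proof.
move=> c0 [K [A fK]].
have [N cN] : exists N : nat, c^-1 <= N%:R.
  by exists (Num.trunc c^-1).+1; rewrite ltW// truncnS_gt.
exists K, (A * N)%N => m; rewrite natrM exprMn normrM.
rewrite [leRHS](_ : _ = K * (A%:R ^+ m / m`!%:R) * N%:R ^+ m); last by ring.
rewrite ler_pM//.
rewrite normfV gtr0_norm ?pochhammer_gt0//.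
elim: m => [|m IH]; first by rewrite /pochhammer big_ord0 invr1 expr0.
rewrite pochhammerS invfM exprSr ler_pM// ?invr_ge0.
- by rewrite ltW// pochhammer_gt0.
- by rewrite addr_ge0// ltW.
- by rewrite (le_trans _ cN)// lef_pV2 ?posrE ?lerDl// ltr_wpDr.
Qed.

Lemma fact_bounded_invfact (R : realType) :
  fact_bounded (fun m => m`!%:R^-1 : R).
Proof. by exists 1, 1%N => m; rewrite expr1n !mul1r ger0_norm. Qed.

Lemma fact_bounded_bessel (R : realType) (c : R) :
  0 < c -> fact_bounded (bessel c).
Proof.
move=> c0.
have := pochhammer_bounded c0 (fact_bounded_invfact R).
by apply: fact_bounded_le => m; rewrite /bessel invfM mulrC.
Qed.

Lemma bessel_diffs (R : realType) (c : R) : 0 < c ->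
  pseries_diffs (bessel c) = fun m => c^-1 * bessel (c + 1) m.
Proof.
move=> c0; apply/funext => m.
rewrite /pseries_diffs /bessel pochhammerSl factS natrM.
have /gt_eqF := pochhammer_gt0 m (ltr_wpDr (@ler01 R) c0).
set p := pochhammer _ _ => /negbT p0.
have f0 : m`!%:R != 0 :> R by rewrite pnatr_eq0 -lt0n fact_gt0.
have m0 : m.+1%:R != 0 :> R by rewrite pnatr_eq0.
by field; rewrite p0 f0 gt_eqF//= nat1r.
Qed.

(** This is Bessel's equation in the variable [x = - r ^ 2 / 4]. *)
Lemma bessel_ode (R : realType) (c x : R) : 0 < c ->
  x * psum (pseries_diffs (pseries_diffs (bessel c))) x
    + c * psum (pseries_diffs (bessel c)) x = psum (bessel c) x.
Proof.
move=> c0; have h := fact_bounded_bessel c0; have h1 := fact_bounded_diffs h.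
rewrite psum_euler// -[X in X + _]mul1r -psum_lin//; last first.
  exact: fact_bounded_euler.
congr (psum _ x); apply/funext => m.
rewrite mul1r -mulrDl addrC /pseries_diffs /bessel pochhammerS factS natrM.
have /gt_eqF := pochhammer_gt0 m c0.
set p := pochhammer _ _ => /negbT p0.
have f0 : m`!%:R != 0 :> R by rewrite pnatr_eq0 -lt0n fact_gt0.
have m0 : m.+1%:R != 0 :> R by rewrite pnatr_eq0.
have cm : c + m%:R != 0 by rewrite gt_eqF// ltr_wpDr.
by field; rewrite p0 f0 cm nat1r m0.
Qed.

(** In the variable [r] the left-hand side is the energy [y ^ 2 + y' ^ 2] of a
    damped oscillator started from rest at height 1; the friction coefficient
    [(2 c - 1) / r] is nonnegative. *)
Lemma bessel_energy (R : realType) (c w : R) : 2^-1 <= c -> 0 <= w ->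
  psum (bessel c) (- w) ^+ 2
    + w * psum (pseries_diffs (bessel c)) (- w) ^+ 2 <= 1.
Proof.
move=> c2 w0; have c0 : 0 < c by lra.
have h := fact_bounded_bessel c0; have h1 := fact_bounded_diffs h.
pose f := psum (bessel c); pose g := psum (pseries_diffs (bessel c)).
pose E x := f x ^+ 2 - x * g x ^+ 2.
have dE x : is_derive x (1 : R) E ((2 * c - 1) * g x ^+ 2).
  have df := is_derive_psum x h; have dg := is_derive_psum x h1.
  have := bessel_ode x c0; rewrite -/f -/g in df dg *.
  set k := psum _ _ in dg *; rewrite -/(g x) -/(f x) => ode.
  apply: is_derive_eq; rewrite /GRing.scale/= -/(g x) -ode.
  by ring.
have := nondecreasing_ray (a := - w) (b := 0) _ (fun x _ => dE x).
rewrite oppr_le0 => /(_ w0) ; rewrite /E mul0r subr0 mulNr opprK.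
rewrite [f 0]psum0// bessel0 expr1n; apply=> x _.
by rewrite mulr_ge0 ?sqr_ge0//; lra.
Qed.

Lemma bessel_le1 (R : realType) (c w : R) : 2^-1 <= c -> 0 <= w ->
  `|psum (bessel c) (- w)| <= 1.
Proof.
move=> c2 w0; rewrite -(@ler_pXn2r _ 2) ?nnegrE// expr1n.
apply: le_trans (bessel_energy c2 w0).
by rewrite real_normK ?num_real// lerDl mulr_ge0// sqr_ge0.
Qed.

(** The energy of the Bessel function of parameter [c - 1] bounds its
    derivative, and this derivative is proportional to the Bessel function of
    parameter [c]. *)
Lemma bessel_decay (R : realType) (c w : R) : 3 / 2 <= c -> 0 < w ->
  `|psum (bessel c) (- w)| <= (c - 1) * w `^ (- 2^-1).
Proof.
move=> c2 w0; have c0 : 0 < c - 1 by lra.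
have c12 : 2^-1 <= c - 1 by lra.
have := bessel_energy c12 (ltW w0); rewrite bessel_diffs// subrK.
have -> (x : R) : psum (fun m => (c - 1)^-1 * bessel c m) x
    = (c - 1)^-1 * psum (bessel c) x.
  have hc : fact_bounded (bessel c) by apply: fact_bounded_bessel; lra.
  have := psum_lin (c - 1)^-1 0 x hc hc.
  by rewrite mul0r addr0 => <-; congr (psum _ x); apply/funext => m; ring.
move=> /(le_trans (ler_wpDl (sqr_ge0 _) (lexx _))) H.
rewrite powRN powR12_sqrt ?(ltW w0)// -ler_pdivrMl//.
rewrite -[_^-1](gtr0_norm (x := (c - 1)^-1)) ?invr_gt0// -normrM.
rewrite -[leRHS]mul1r ler_pdivlMr ?sqrtr_gt0//.
rewrite -(@ler_pXn2r _ 2) ?nnegrE ?mulr_ge0// expr1n exprMn sqr_sqrtr ?(ltW w0)//.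
by rewrite real_normK ?num_real// mulrC.
Qed.

(** * Weighted averages *)

(** The quotient (a)_m / (a + 1)_m of Pochhammer symbols is [a / (a + m)]; at
    the level of functions this is the average
    [x |-> a * \int_0^1 s ^ (a - 1) * f (s x) ds]. *)
Definition avg (R : realType) (a : R) (f : nat -> R) (m : nat) : R :=
  a / (a + m%:R) * f m.

Lemma fact_bounded_avg (R : realType) (a : R) (f : nat -> R) :
  0 < a -> fact_bounded f -> fact_bounded (avg a f).
Proof.
move=> a0; apply: fact_bounded_le => m.
rewrite /avg normrM ler_piMl// ger0_norm; last first.
  by rewrite divr_ge0 ?addr_ge0// ltW.
by rewrite ler_pdivrMr ?mul1r ?lerDl// ltr_wpDr.
Qed.

Lemma avg_euler (R : realType) (a x : R) (f : nat -> R) :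
  0 < a -> fact_bounded f ->
  a * psum (avg a f) x + x * psum (pseries_diffs (avg a f)) x
    = a * psum f x.
Proof.
move=> a0 hf; have h := fact_bounded_avg a0 hf.
rewrite psum_euler// -[X in _ + X]mul1r -psum_lin//; last first.
  exact: fact_bounded_euler.
have := psum_lin a 0 x hf hf; rewrite mul0r addr0 => <-.
congr (psum _ x); apply/funext => m; rewrite mul0r addr0 mul1r -mulrDl /avg.
by rewrite mulrA [_ * (a / _)]mulrC divfK// gt_eqF// ltr_wpDr.
Qed.

(** This is the derivative of [w ^ a * avg(w) = a * \int_0^w s ^ (a - 1) f(s)
    ds], which is why the averages are compared through it. *)
Lemma is_derive_powR_avg (R : realType) (a w : R) (f : nat -> R) :
  0 < a -> 0 < w -> fact_bounded f ->
  is_derive w (1 : R) (fun w => w `^ a * psum (avg a f) (- w))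
    (a * w `^ (a - 1) * psum f (- w)).
Proof.
move=> a0 w0 hf; have h := fact_bounded_avg a0 hf.
have dP := is_derive1_powR a w0.
have dN : is_derive w (1 : R) -%R (-1).
  by apply: is_derive_eq.
have dA := is_derive_psum (- w) h.
have dC : is_derive w (1 : R) (fun w => psum (avg a f) (- w))
    (- psum (pseries_diffs (avg a f)) (- w)).
  have := @is_derive1_comp _ (psum (avg a f)) -%R w _ _ dA dN.
  by rewrite mulrN1.
apply: is_derive_eq; rewrite /GRing.scale/=.
rewrite [_ * _ * psum f _]mulrAC -avg_euler// -mulr_powRB1 ?(ltW w0)//.
by ring.
Qed.

(** The derivative of [w ^ a * avg(w)] is nonnegative. *)
Lemma avg_lower (R : realType) (a w : R) (f : nat -> R) :
  0 < a -> fact_bounded f -> (forall w, 0 < w -> 0 <= psum f (- w)) ->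
  1 <= w -> psum (avg a f) (- 1) <= w `^ a * psum (avg a f) (- w).
Proof.
move=> a0 hf f0 w1.
have := nondecreasing_ray (f := fun w => w `^ a * psum (avg a f) (- w)) w1.
rewrite powR1 mul1r; apply=> x x1; have x0 : 0 < x by lra.
  exact: is_derive_powR_avg.
by rewrite !mulr_ge0 ?powR_ge0 ?f0// ltW.
Qed.

(** The derivative of [w ^ a * avg(w)] is dominated by a multiple of
    [w ^ (a - k - 1)], whose primitive [w ^ (a - k) / (a - k)] grows as [k < a];
    so decay slower than [w ^ (- a)] passes to averages. *)
Lemma avg_upper (R : realType) (a k C : R) (f : nat -> R) :
  0 < k < a -> fact_bounded f ->
  (forall w, 1 <= w -> `|psum f (- w)| <= C * w `^ (- k)) ->
  exists2 D : R, 0 <= D &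
    forall w, 1 <= w -> `|psum (avg a f) (- w)| <= D * w `^ (- k).
Proof.
move=> /andP[k0 ka] hf fC; have a0 : 0 < a by lra.
have ak : 0 < a - k by lra.
have C0 : 0 <= C.
  by have := le_trans (normr_ge0 _) (fC 1 (lexx _)); rewrite powR1 mulr1.
pose p (w : R) := w `^ a * psum (avg a f) (- w).
pose q (w : R) := C * a / (a - k) * w `^ (a - k).
have q1 : 0 <= q 1 by rewrite /q powR1 mulr1 divr_ge0 ?mulr_ge0 ?(ltW a0) ?(ltW ak).
have dq (w : R) : 0 < w ->
    is_derive w (1 : R) q (a * w `^ (a - 1) * (C * w `^ (- k))).
  move=> w0; have dP := is_derive1_powR (a - k) w0.
  apply: is_derive_eq; rewrite /GRing.scale/= mulrCA -mulrA -mulrA.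
  rewrite [w `^ _ * (C * _)]mulrCA -powRD ?(gt_eqF w0) ?implybT//.
  have -> : a - 1 + - k = a - k - 1 by ring.
  by field; rewrite gt_eqF.
have dp (w : R) : 0 < w -> is_derive w (1 : R) p (a * w `^ (a - 1) * psum f (- w)).
  by move=> w0; exact: is_derive_powR_avg.
have key (s w : R) : `|s| = 1 -> 1 <= w -> s * p w <= q w + `|p 1|.
  move=> s1 w1.
  have : q 1 - s * p 1 <= q w - s * p w.
    apply: (@nondecreasing_ray _ (fun w => q w - s * p w)
      (fun w => a * w `^ (a - 1) * (C * w `^ (- k))
             - s * (a * w `^ (a - 1) * psum f (- w)))) => // x x1.
      have x0 : 0 < x by lra.
      have := dq x x0; have := dp x x0 => dpx dqx.
      by apply: is_derive_eq; rewrite /GRing.scale/=; ring.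
    rewrite [s * _]mulrCA -mulrBr mulr_ge0 ?mulr_ge0 ?powR_ge0 ?(ltW a0)//.
    rewrite subr_ge0 (le_trans (ler_norm _))// normrM s1 mul1r.
    exact: fC.
  have : s * p 1 <= `|p 1| by rewrite (le_trans (ler_norm _))// normrM s1 mul1r.
  by lra.
exists (C * a / (a - k) + `|p 1|).
  by rewrite addr_ge0// divr_ge0 ?mulr_ge0 ?(ltW a0) ?(ltW ak).
move=> w w1; have w0 : 0 < w by lra.
have wa : 0 < w `^ a by rewrite powR_gt0.
rewrite -(ler_pM2l wa) mulrCA -powRD ?(gt_eqF w0) ?implybT//.
rewrite -[X in X * `|_|](gtr0_norm wa) -normrM -/(p w).
have pw : `|p 1| <= `|p 1| * w `^ (a - k).
  rewrite ler_peMr//; have := ler_powR w1 (ltW ak); by rewrite powRr0.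
have := key 1 w; have := key (- 1) w; rewrite normrN normr1.
move=> /(_ erefl w1) h1 /(_ erefl w1) h2.
by rewrite mulrDl -/(q w) ler_norml; apply/andP; split; lra.
Qed.

(** * The hypergeometric factors of the multipliers *)

(** The coefficients of 1F2(1; 2, c; x). *)
Definition bessel_quotient (R : realType) (c : R) (m : nat) : R :=
  (pochhammer c m * m.+1`!%:R)^-1.

Lemma fact_bounded_bessel_quotient (R : realType) (c : R) :
  0 < c -> fact_bounded (bessel_quotient c).
Proof.
move=> c0; apply: fact_bounded_le (fact_bounded_bessel c0) => m.
have p0 := pochhammer_gt0 m c0.
rewrite !ger0_norm ?invr_ge0 ?mulr_ge0 ?(ltW p0)//.
rewrite lef_pV2 ?posrE ?mulr_gt0 ?ltr0n ?fact_gt0//.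
by rewrite ler_pM2l// ler_nat factS leq_pmull.
Qed.

(** The function is the difference quotient at 0 of a Bessel function bounded
    by its value 1 at 0, up to a positive factor. *)
Lemma bessel_quotient_ge0 (R : realType) (c w : R) : 3 / 2 <= c -> 0 < w ->
  0 <= psum (bessel_quotient c) (- w).
Proof.
move=> c2 w0; have c0 : 0 < c - 1 by lra.
have c12 : 2^-1 <= c - 1 by lra.
have h : fact_bounded (bessel_quotient c).
  by apply: fact_bounded_bessel_quotient; lra.
have hb := fact_bounded_bessel c0.
have := psum_recl (- w) (fact_boundedS hb); rewrite bessel0.
have -> : (fun m => bessel (c - 1) m.+1)
    = (fun m => (c - 1)^-1 * bessel_quotient c m + 0 * bessel_quotient c m).
  apply/funext => m; rewrite mul0r addr0 /bessel /bessel_quotient.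
  by rewrite pochhammerSl subrK -mulrA invfM.
rewrite psum_lin// mul0r addr0 => E.
have := bessel_le1 c12 (ltW w0); rewrite ler_norml => /andP[_].
rewrite E gerDl mulNr oppr_le0 mulrCA pmulr_rge0 ?invr_gt0//.
by rewrite pmulr_rge0.
Qed.

Lemma pFqE (R : realType) (a b : seq R) (f : nat -> R) (x : R) :
  (forall m, (\prod_(c <- a) pochhammer c m) / (\prod_(c <- b) pochhammer c m)
     / m`!%:R = f m) ->
  pFq a b x = psum f x.
Proof.
move=> fE; rewrite /pFq /psum /pseries; congr (limn (series _)).
by apply/funext => m; rewrite /= -fE; ring.
Qed.

Lemma pochhammer_ratio (R : realType) (a : R) (m : nat) : 0 < a ->
  pochhammer a m / pochhammer (a + 1) m = a / (a + m%:R).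
Proof.
move=> a0; have a1 : 0 < a + 1 by lra.
have am : 0 < a + m%:R by rewrite ltr_wpDr.
have /gt_eqF/negbT p0 := pochhammer_gt0 m a1.
apply/eqP; rewrite eqr_div//; last by rewrite gt_eqF.
by rewrite -pochhammerS pochhammerSl.
Qed.

Lemma pFq_1F2 (R : realType) (a c x : R) : 0 < a -> 0 < c ->
  pFq [:: a] [:: c; a + 1] x = psum (avg a (bessel c)) x.
Proof.
move=> a0 c0; apply: pFqE => m; rewrite !big_cons !big_nil !mulr1 /avg /bessel.
by rewrite -pochhammer_ratio// !invfM; ring.
Qed.

Lemma pFq_2F3 (R : realType) (a c x : R) : 0 < a -> 0 < c ->
  pFq [:: 1; a] [:: 2; c; a + 1] x = psum (avg a (bessel_quotient c)) x.
Proof.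
move=> a0 c0; apply: pFqE => m; rewrite !big_cons !big_nil !mulr1.
rewrite /avg /bessel_quotient pochhammer1 pochhammer2.
rewrite -pochhammer_ratio// !invfM.
have f0 : m`!%:R != 0 :> R by rewrite pnatr_eq0 -lt0n fact_gt0.
have f1 : (m.+1)`!%:R != 0 :> R by rewrite pnatr_eq0 -lt0n fact_gt0.
have p0 : pochhammer c m != 0 by rewrite gt_eqF// pochhammer_gt0.
have a1 : 0 < a + 1 by lra.
have p1 : pochhammer (a + 1) m != 0 by rewrite gt_eqF// pochhammer_gt0.
by field; rewrite f0 f1 p0 p1.
Qed.

(** The quotient (5/2)_m / (3/2)_m is [(3 + 2 m) / 3], and
    [3 + 2 m = (3 - 2 a) + 2 (a + m)]. *)
Lemma pFq_3F4 (R : realType) (a c x : R) : 0 < a -> 0 < c ->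
  3 * pFq [:: 1; 5 / 2; a] [:: 2; 3 / 2; c; a + 1] x
    = (3 - 2 * a) * psum (avg a (bessel_quotient c)) x
        + 2 * a * psum (bessel_quotient c) x.
Proof.
move=> a0 c0.
have hq := fact_bounded_bessel_quotient c0; have hA := fact_bounded_avg a0 hq.
rewrite -psum_lin//.
rewrite (pFqE (f := fun m => (1 - 2 / 3 * a) * avg a (bessel_quotient c) m
                   + 2 / 3 * a * bessel_quotient c m)).
  by rewrite !psum_lin//; field.
move=> m; rewrite !big_cons !big_nil !mulr1.
rewrite /avg /bessel_quotient pochhammer1 pochhammer2.
have r0 : 0 < 3 / 2 :> R by lra.
have r1 : 0 < 3 / 2 + 1 :> R by lra.
have := pochhammer_ratio m r0.
have -> : 3 / 2 + 1 = 5 / 2 :> R by field.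
have := pochhammer_ratio m a0.
have f0 : m`!%:R != 0 :> R by rewrite pnatr_eq0 -lt0n fact_gt0.
have f1 : (m.+1)`!%:R != 0 :> R by rewrite pnatr_eq0 -lt0n fact_gt0.
have p0 : pochhammer c m != 0 by rewrite gt_eqF// pochhammer_gt0.
have a1 : 0 < a + 1 by lra.
have p1 : pochhammer (a + 1) m != 0 by rewrite gt_eqF// pochhammer_gt0.
have p3 : pochhammer (3 / 2 : R) m != 0 by rewrite gt_eqF// pochhammer_gt0.
have p5 : pochhammer (5 / 2 : R) m != 0.
  by rewrite gt_eqF// pochhammer_gt0//; lra.
have am : a + m%:R != 0 by rewrite gt_eqF// ltr_wpDr.
have bm : 3 + 2 * m%:R != 0 :> R by rewrite gt_eqF// ltr_wpDr// mulr_ge0.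
move: (pochhammer a m) (pochhammer (a + 1) m) p1 => u v v0 uv.
have -> : u = a / (a + m%:R) * v by rewrite -uv divfK.
move: (pochhammer (3 / 2) m) (pochhammer (5 / 2) m) p3 p5 => r s r00 s00 rs.
have -> : s = (3 + 2 * m%:R) / 3 * r.
  have -> : r = 3 / 2 / (3 / 2 + m%:R) * s by rewrite -rs divfK.
  by field; rewrite mulrC bm.
by field; rewrite f0 f1 p0 v0 r00 am.
Qed.

(** * Growth of the multipliers *)

(** With [a = (n + 2 - beta) / 2] and [c = (n + 4) / 2], the multipliers are
    [- |nu| ^ 2] times these functions of [w = |nu| ^ 2 delta ^ 2 / 4]. *)
Definition profile2 (R : realType) (a c mu w : R) : R :=
  mu * psum (avg a (bessel_quotient c)) (- w).

Definition profile1 (R : realType) (a c mu lam w : R) : R :=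
  mu * ((3 - 2 * a) * psum (avg a (bessel_quotient c)) (- w)
        + 2 * a * psum (bessel_quotient c) (- w))
    + (lam - mu) * psum (avg a (bessel (c - 1))) (- w) ^+ 2.

Lemma lambda2E (R : realType) (n : nat) (mu delta beta : R) (nu : 'cV[R]_n) :
  beta < n%:R + 2 ->
  lambda2 mu delta beta nu =
    - (sqnorm nu * profile2 ((n%:R + 2 - beta) / 2) ((n%:R + 4) / 2) mu
         (sqnorm nu * (delta ^+ 2 / 4))).
Proof.
move=> bn; have n0 := ler0n R n; rewrite /lambda2 /profile2.
have -> : (n%:R + 4 - beta) / 2 = (n%:R + 2 - beta) / 2 + 1 by field.
rewrite pFq_2F3; [|lra|lra].
have -> : - (sqnorm nu * delta ^+ 2) / 4 = - (sqnorm nu * (delta ^+ 2 / 4)).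
  by field.
by ring.
Qed.

Lemma lambda1E (R : realType) (n : nat) (mu lam delta beta : R)
    (nu : 'cV[R]_n) :
  beta < n%:R + 2 ->
  lambda1 mu lam delta beta nu =
    - (sqnorm nu * profile1 ((n%:R + 2 - beta) / 2) ((n%:R + 4) / 2) mu lam
         (sqnorm nu * (delta ^+ 2 / 4))).
Proof.
move=> bn; have n0 := ler0n R n; rewrite /lambda1 /profile1.
have -> : (n%:R + 4 - beta) / 2 = (n%:R + 2 - beta) / 2 + 1 by field.
have -> : (n%:R + 2) / 2 = (n%:R + 4) / 2 - 1 :> R by field.
rewrite pFq_1F2; [|lra|lra].
rewrite [3 * mu]mulrC -[mu * 3 * _]mulrA pFq_3F4; [|lra|lra].
have -> : - (sqnorm nu * delta ^+ 2) / 4 = - (sqnorm nu * (delta ^+ 2 / 4)).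
  by field.
by ring.
Qed.

Lemma continuous_psumN (R : realType) (f : nat -> R) : fact_bounded f ->
  continuous (fun w => psum f (- w)).
Proof.
move=> hf w; apply: (@continuous_comp _ _ _ -%R (psum f)).
  exact: opp_continuous.
exact: continuous_psum.
Qed.

Lemma continuous_profile2 (R : realType) (a c mu : R) : 0 < a -> 0 < c ->
  continuous (profile2 a c mu).
Proof.
move=> a0 c0 w; apply: cvgM; first exact: cvg_cst.
apply: continuous_psumN; apply: fact_bounded_avg => //.
exact: fact_bounded_bessel_quotient.
Qed.

Lemma continuous_profile1 (R : realType) (a c mu lam : R) : 0 < a -> 1 < c ->
  continuous (profile1 a c mu lam).
Proof.
move=> a0 c1 w; have hq : fact_bounded (bessel_quotient c).
  by apply: fact_bounded_bessel_quotient; lra.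
have hb : fact_bounded (avg a (bessel (c - 1))).
  by apply: fact_bounded_avg => //; apply: fact_bounded_bessel; lra.
have hA := fact_bounded_avg a0 hq.
rewrite /profile1; apply: cvgD; apply: cvgM; try exact: cvg_cst; last first.
  rewrite expr2; under eq_fun do rewrite expr2.
  by apply: cvgM; exact: continuous_psumN.
by apply: cvgD; apply: cvgM; try exact: cvg_cst; exact: continuous_psumN.
Qed.

Lemma bessel_quotient_at0 (R : realType) (c : R) :
  0 < c -> psum (bessel_quotient c) 0 = 1.
Proof.
move=> c0; rewrite psum0; last exact: fact_bounded_bessel_quotient.
by rewrite /bessel_quotient /pochhammer big_ord0 mulr1 invr1.
Qed.

Lemma avg_at0 (R : realType) (a : R) (f : nat -> R) :
  0 < a -> fact_bounded f -> psum (avg a f) 0 = psum f 0.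
Proof.
move=> a0 hf; rewrite !psum0//; last exact: fact_bounded_avg.
by rewrite /avg addr0 divff ?mul1r// gt_eqF.
Qed.

Lemma profile2_at0 (R : realType) (a c mu : R) : 0 < a -> 0 < c ->
  profile2 a c mu 0 = mu.
Proof.
move=> a0 c0; rewrite /profile2 oppr0 avg_at0 ?bessel_quotient_at0 ?mulr1//.
exact: fact_bounded_bessel_quotient.
Qed.

Lemma profile1_at0 (R : realType) (a c mu lam : R) : 0 < a -> 1 < c ->
  profile1 a c mu lam 0 = lam + 2 * mu.
Proof.
move=> a0 c1; have c0 : 0 < c by lra.
have c10 : 0 < c - 1 by lra.
have hq := fact_bounded_bessel_quotient c0.
have hb := fact_bounded_bessel c10.
rewrite /profile1 oppr0 !avg_at0// bessel_quotient_at0// psum0// bessel0.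
by ring.
Qed.

(** The profile is the average of a nonnegative function. *)
Lemma profile2_growth (R : realType) (a c mu w : R) :
  0 < a -> 3 / 2 <= c -> 0 < mu -> 1 <= w ->
  profile2 a c mu 1 <= w `^ a * profile2 a c mu w.
Proof.
move=> a0 c2 mu0 w1; have c0 : 0 < c by lra.
rewrite /profile2 mulrCA ler_pM2l//; apply: avg_lower => //.
  exact: fact_bounded_bessel_quotient.
by move=> x x0; exact: bessel_quotient_ge0.
Qed.

(** The square of a Bessel average decays faster than [w ^ (- a)]: Bessel
    functions of the parameter at hand are [O(w ^ (- 1 / 2))], hence [O(w ^ (-
    k))] for [k = a - a ^ 2 / 2 <= 1 / 2], and so are their averages as [k <
    a]; and [a < 2 k] as [a < 1]. *)
Lemma bessel_avg_decay (R : realType) (a c : R) : 0 < a < 1 -> 3 / 2 <= c ->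
  exists D e : R, [/\ 0 <= D, 0 < e & forall w, 1 <= w ->
    w `^ a * psum (avg a (bessel c)) (- w) ^+ 2 <= D * w `^ (- e)].
Proof.
move=> /andP[a0 a1] c2; pose k := a - a ^+ 2 / 2.
have a20 : 0 < a ^+ 2 by rewrite exprn_gt0.
have a2a : a ^+ 2 < a by rewrite expr2 gtr_pMr.
have kP : 0 < k < a by rewrite /k; apply/andP; split; lra.
have k2 : k <= 2^-1.
  by have := sqr_ge0 (1 - a); rewrite /k !expr2; lra.
have hb : fact_bounded (bessel c) by apply: fact_bounded_bessel; lra.
have [|D D0 DP] := avg_upper (C := c - 1) kP hb.
  move=> w w1; have w0 : 0 < w by lra.
  apply: le_trans (bessel_decay c2 w0) _.
  by rewrite ler_wpM2l ?ler_powR// ?lerN2//; lra.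
exists (D ^+ 2), (2 * k - a); split=> [||w w1].
- exact: sqr_ge0.
- by rewrite /k; lra.
have w0 : 0 < w by lra.
have -> : - (2 * k - a) = a + (- k + - k) by ring.
rewrite !powRD ?(gt_eqF w0) ?implybT//.
rewrite [D ^+ 2 * _]mulrCA ler_wpM2l ?powR_ge0//.
rewrite -expr2 -exprMn -[leLHS]real_normK ?num_real//.
by rewrite lerXn2r ?nnegrE ?mulr_ge0 ?powR_ge0// DP.
Qed.

Lemma powRN_small (R : realType) (e eps : R) : 0 < e -> 0 < eps ->
  exists2 W : R, 1 <= W & forall w, W <= w -> w `^ (- e) <= eps.
Proof.
move=> e0 eps0; exists (1 + eps^-1 `^ e^-1); first by rewrite lerDl powR_ge0.
move=> w Ww; have i0 : 0 < eps^-1 by rewrite invr_gt0.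
have w1 : eps^-1 `^ e^-1 <= w by lra.
have : (eps^-1 `^ e^-1) `^ e <= w `^ e.
  have := powR_ge0 eps^-1 e^-1 => p0.
  by apply: ge0_ler_powR; rewrite ?nnegrE ?(ltW e0)//; lra.
rewrite -powRrM mulVf ?gt_eqF// powRr1 ?(ltW i0)// powRN => H.
by rewrite invf_ple ?posrE// powR_gt0//; have := powR_ge0 eps^-1 e^-1; lra.
Qed.

(** The first two terms dominate [profile2] because [3 - 2 a >= 1]; the square
    decays faster than [w ^ (- a)], hence is absorbed for large [w] even when
    [lam < mu]. *)
Lemma profile1_growth (R : realType) (a c mu lam : R) :
  0 < a < 1 -> 5 / 2 <= c -> 0 < mu -> 0 < profile2 a c mu 1 ->
  exists W d : R, [/\ 1 <= W, 0 < d & forall w, W <= w ->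
    d <= w `^ a * profile1 a c mu lam w].
Proof.
move=> /[dup] a01 /andP[a0 a1] c2 mu0 p0.
have c32 : 3 / 2 <= c by lra.
have c1 : 3 / 2 <= c - 1 by lra.
have [D [e [D0 e0 DP]]] := bessel_avg_decay a01 c1.
set p := profile2 a c mu 1 in p0.
have M0 : 0 < `|lam - mu| * D + 1.
  by rewrite ltr_wpDl ?mulr_ge0.
have [||W W1 WP] := @powRN_small _ e (p / 2 / (`|lam - mu| * D + 1)) => //.
  by rewrite !divr_gt0.
exists W, (p / 2); split=> // [|w Ww]; first by rewrite divr_gt0.
have w1 : 1 <= w by lra.
have w0 : 0 < w by lra.
have G2 := profile2_growth a0 c32 mu0 w1.
rewrite -/p in G2.
have q0 : 0 <= psum (bessel_quotient c) (- w) by exact: bessel_quotient_ge0.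
rewrite /profile1 mulrDr.
have G1 : p <= w `^ a * (mu * ((3 - 2 * a) *
    psum (avg a (bessel_quotient c)) (- w)
    + 2 * a * psum (bessel_quotient c) (- w))).
  apply: le_trans G2 _; rewrite ler_wpM2l ?powR_ge0// /profile2 ler_pM2l//.
  have A0 : 0 <= psum (avg a (bessel_quotient c)) (- w).
    have := lt_le_trans p0 (profile2_growth a0 c32 mu0 w1).
    by rewrite /profile2 pmulr_rgt0 ?powR_gt0// pmulr_rgt0// => /ltW.
  have : 0 <= 2 * a * psum (bessel_quotient c) (- w).
    by rewrite !mulr_ge0// ltW.
  have : psum (avg a (bessel_quotient c)) (- w) <=
      (3 - 2 * a) * psum (avg a (bessel_quotient c)) (- w).
    by rewrite ler_peMl//; lra.
  by lra.
have H2 := DP w w1; have H3 := WP w Ww.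
rewrite ler_pdivlMr// in H3.
rewrite [X in _ + X]mulrCA.
set h := w `^ a * psum (avg a (bessel (c - 1))) (- w) ^+ 2 in H2 *.
have h0 : 0 <= h by rewrite mulr_ge0 ?powR_ge0 ?sqr_ge0.
have v0 := powR_ge0 w (- e).
have H4 : - (`|lam - mu| * h) <= (lam - mu) * h.
  rewrite -mulNr ler_wpM2r// lerNl; have := ler_norm (- (lam - mu)).
  by rewrite normrN.
have H5 : `|lam - mu| * h <= `|lam - mu| * (D * w `^ (- e)).
  by rewrite ler_wpM2l.
have H6 : `|lam - mu| * (D * w `^ (- e)) <= p / 2.
  by move: H3; rewrite mulrDr mulr1 mulrCA mulrC -mulrA; nra.
by lra.
Qed.

(** On a compact interval a positive continuous function has a positive
    minimum. *)
Lemma ray_lower_bound (R : realType) (a W d : R) (g : R -> R) :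
  0 < a -> 0 <= W -> 0 < d -> continuous g -> (forall w, 0 <= w -> 0 < g w) ->
  (forall w, W <= w -> d <= w `^ a * g w) ->
  exists2 K : R, 0 < K & forall w, 0 <= w -> K <= (1 + w) `^ a * g w.
Proof.
move=> a0 W0 d0 cg g0 gW.
have [m] := EVT_min W0 (continuous_subspaceT cg).
rewrite in_itv/= => /andP[m0 _] gm.
exists (Num.min (g m) d); first by rewrite lt_min g0//.
move=> w w0; have gw := g0 w w0; rewrite ge_min; apply/orP.
have w1 : 0 <= 1 + w by lra.
have [wW|/ltW Ww] := leP w W; [left|right].
  apply: le_trans (gm w _) _; first by rewrite in_itv/= w0.
  rewrite ler_peMl ?(ltW gw)//.
  have /ler_powR/(_ _ _ (ltW a0)) : 1 <= 1 + w by lra.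
  by rewrite powRr0.
apply: le_trans (gW w Ww) _; rewrite ler_wpM2r ?(ltW gw)//.
by apply: ge0_ler_powR; rewrite ?nnegrE ?(ltW a0)//; lra.
Qed.

(** Here [N] stands for [|k| ^ 2] and [eta] for [delta ^ 2 / 4]: the two are
    separated by [1 + N eta <= (1 + N) (1 + eta)], and [N >= (1 + N) / 2]. *)
Lemma symbol_lower_bound (R : realType) (a K N eta : R) (g : R -> R) :
  0 < a -> 0 < K -> (forall w, 0 <= w -> K <= (1 + w) `^ a * g w) ->
  1 <= N -> 0 <= eta ->
  K / 2 * (1 + eta) `^ (- a) * (1 + N) `^ (1 - a) <= N * g (N * eta).
Proof.
move=> a0 K0 gK N1 e0; have Ne : 0 <= N * eta by rewrite mulr_ge0//; lra.
have N10 : 0 < 1 + N by lra.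
have e10 : 0 < 1 + eta by lra.
have P0 : 0 < (1 + N) `^ a by rewrite powR_gt0.
have Q0 : 0 < (1 + eta) `^ a by rewrite powR_gt0.
have := gK _ Ne; set G := g _ => KG.
have G0 : 0 < G.
  have := lt_le_trans K0 KG; rewrite pmulr_rgt0// powR_gt0//; lra.
have KPQ : K <= (1 + eta) `^ a * (1 + N) `^ a * G.
  apply: le_trans KG _; rewrite ler_wpM2r ?(ltW G0)//.
  rewrite -powRM ?(ltW e10) ?(ltW N10)//.
  apply: ge0_ler_powR; rewrite ?nnegrE ?(ltW a0)//; nra.
rewrite powRN powRB ?(gt_eqF N10) ?implybT// powRr1 ?(ltW N10)//.
have -> : K / 2 * ((1 + eta) `^ a)^-1 * ((1 + N) / (1 + N) `^ a) =
    (1 + N) / 2 * (K / ((1 + eta) `^ a * (1 + N) `^ a)).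
  by field; rewrite !gt_eqF.
rewrite ler_pM//; first 2 last.
- by lra.
- by rewrite ler_pdivrMr ?mulr_gt0// mulrC.
- by lra.
- by rewrite divr_ge0 ?mulr_ge0 ?ltW.
Qed.

(** * Uniqueness for the wave equation of each Fourier mode *)

(** Differentiability on the closed half-line, one-sided at its endpoint. *)
Definition halfline_derivative (R : realType) (f f' : R -> R) :=
  forall t : R, 0 <= t ->
    (s - t)^-1 * (f s - f t) - f' t
      @[s --> within [set s : R | 0 <= s] t^'] --> (0 : R).

Lemma halfline_derivativeD (R : realType) (f f' g g' : R -> R) (a b : R) :
  halfline_derivative f f' -> halfline_derivative g g' ->
  halfline_derivative (fun t => a * f t + b * g t)
    (fun t => a * f' t + b * g' t).
Proof.
move=> df dg t t0; have cf := df t t0; have cg := dg t t0.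
have : a * ((s - t)^-1 * (f s - f t) - f' t)
    + b * ((s - t)^-1 * (g s - g t) - g' t)
    @[s --> within [set s : R | 0 <= s] t^'] --> a * 0 + b * 0.
  by apply: cvgD; apply: cvgM => //; exact: cvg_cst.
rewrite !mulr0 addr0; apply: cvg_trans; apply: near_eq_cvg; near=> s.
by ring.
Unshelve. all: by end_near. Qed.

Lemma halfline_derivative_sum (R : realType) (n : nat) (c : 'I_n -> R)
    (f f' : 'I_n -> R -> R) :
  (forall i, halfline_derivative (f i) (f' i)) ->
  halfline_derivative (fun t => \sum_i c i * f i t)
    (fun t => \sum_i c i * f' i t).
Proof.
elim: n c f f' => [|n IH] c f f' df.
  move=> t t0; rewrite [X in X @ _ --> _](_ : _ = (fun=> 0)).
    exact: cvg_cst.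
  by apply/funext => s; rewrite !big_ord0 !subr0 mulr0.
have := halfline_derivativeD (c ord0) 1 (df ord0)
  (IH (c \o lift ord0) _ _ (fun i => df (lift ord0 i))).
by congr halfline_derivative; apply/funext => t; rewrite mul1r big_ord_recl.
Qed.

Lemma halfline_is_derive (R : realType) (f f' : R -> R) (t : R) :
  halfline_derivative f f' -> 0 < t -> is_derive t (1 : R) f (f' t).
Proof.
move=> df t0.
have ht : h + t @[h --> (0 : R)^'] --> within [set s : R | 0 <= s] t^'.
  move=> A; rewrite /dnbhs /within /= => /nbhs_ballP[r r0 hr].
  apply/nbhs_ballP; exists (Num.min r t); first by rewrite /= lt_min r0.
  move=> h; rewrite /ball/= sub0r normrN lt_min => /andP[hr' ht] h0.
  apply: hr.
  - by rewrite /ball/= opprD addrCA subrr addr0 normrN.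
  - by rewrite -subr_eq0 addrK.
  - by move: ht; rewrite ltr_norml => /andP[? _]; lra.
have H : h^-1 *: (f (h *: 1 + t) - f t) @[h --> (0 : R)^'] --> f' t.
  have := cvg_comp _ _ ht (df t (ltW t0)) => /(cvgD (cvg_cst (f' t))).
  rewrite addr0; apply: cvg_trans; apply: near_eq_cvg; near=> h.
  rewrite !fctE/= /GRing.scale/= mulr1 addrK; ring.
split; first by apply/cvg_ex; exists (f' t).
exact/cvg_lim.
Unshelve. all: by end_near. Qed.

Lemma halfline_continuous (R : realType) (f f' : R -> R) (T : R) :
  halfline_derivative f f' -> 0 < T -> {within `[0, T], continuous f}.
Proof.
move=> df T0.
have cf (x : R) : 0 < x -> {for x, continuous f}.
  move=> x0; apply/differentiable_continuous/derivable1_diffP.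
  by have [] := halfline_is_derive df x0.
apply/continuous_within_itvP => //; split.
- by move=> x; rewrite in_itv/= => /andP[x0 _]; exact: cf.
- have h0 : (fun s : R => s) @ (0 : R)^'+ --> within [set s : R | 0 <= s] 0^'.
    move=> A; rewrite /at_right /dnbhs /within /= => /nbhs_ballP[r r0 hr].
    apply/nbhs_ballP; exists r => // s rs s0; apply: hr => //; last exact: ltW.
    by rewrite gt_eqF.
  have := cvg_comp _ _ h0 (df 0 (lexx _)) => H.
  have s0 : (fun s : R => s) @ (0 : R)^'+ --> (0 : R).
    by apply: cvg_within_filter; exact: cvg_id.
  have : f 0 + s * (((s - 0)^-1 * (f s - f 0) - f' 0) + f' 0)
      @[s --> (0 : R)^'+] --> f 0 + 0 * (0 + f' 0).
    apply: cvgD; first exact: cvg_cst.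
    by apply: cvgM => //; apply: cvgD => //; exact: cvg_cst.
  rewrite mul0r addr0; apply: cvg_trans; apply: near_eq_cvg; near=> s.
  have s00 : 0 < s by [].
  by rewrite subr0 subrK mulrA divff ?gt_eqF// mul1r addrC subrK.
- by apply: cvg_within_filter; exact: cf.
Unshelve. all: by end_near. Qed.

Lemma halfline_constant (R : realType) (E : R -> R) :
  (forall t : R, 0 < t -> is_derive t (1 : R) E 0) ->
  (forall T : R, 0 < T -> {within `[0, T], continuous E}) ->
  forall t : R, 0 <= t -> E t = E 0.
Proof.
move=> dE cE t; rewrite le_eqVlt => /predU1P[<-//|t0].
have [|c _ H] := MVT t0 (f := E) (df := fun=> 0) _ (cE t t0).
  by move=> x; rewrite in_itv/= => /andP[x0 _]; exact: dE.
by apply/eqP; rewrite -subr_eq0 H mul0r.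
Qed.

(** The energy [z ^ 2 - l w ^ 2] is conserved, hence zero; so the velocity
    vanishes. *)
Lemma oscillator_unique (R : realType) (l : R) (w z : R -> R) : l <= 0 ->
  halfline_derivative w z -> halfline_derivative z (fun t => l * w t) ->
  w 0 = 0 -> z 0 = 0 -> forall t : R, 0 <= t -> w t = 0.
Proof.
move=> l0 dw dz w0 z0.
have z_eq0 t : 0 <= t -> z t = 0.
  move=> t0.
  have : z t * z t - l * (w t * w t) = z 0 * z 0 - l * (w 0 * w 0).
    apply: (@halfline_constant _ (fun t => z t * z t - l * (w t * w t))) t0.
      move=> x x0; have dwx := halfline_is_derive dw x0.
      have dzx := halfline_is_derive dz x0.
      by apply: is_derive_eq; rewrite /GRing.scale/=; ring.
    move=> T T0 x; have cw := @halfline_continuous _ _ _ T dw T0 x.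
    have cz := @halfline_continuous _ _ _ T dz T0 x.
    by apply: cvgB; apply: cvgM => //; [exact: cvg_cst|exact: cvgM].
  rewrite w0 z0 !mulr0 subr0 => E; apply/eqP; rewrite -sqrf_eq0 expr2.
  have := sqr_ge0 (z t); have := sqr_ge0 (w t); rewrite !expr2 => h1 h2.
  by rewrite eq_le h2 andbT; nra.
move=> t t0; rewrite -[RHS]w0; apply: halfline_constant t0.
  move=> x x0; have := halfline_is_derive dw x0.
  by rewrite z_eq0// ltW.
by move=> T T0; exact: halfline_continuous dw T0.
Qed.

(** Covers the real and the imaginary part by one argument. *)
Definition real_coordinate (R : realType) (p : R[i] -> R) :=
  [/\ forall x y, p (x + y) = p x + p y,
      forall r x, p (real_complex R r * x) = r * p x
    & forall x, p x ^+ 2 <= complex.Re x ^+ 2 + complex.Im x ^+ 2].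

Lemma real_coordinate_Re (R : realType) : real_coordinate (@complex.Re R).
Proof.
split=> [[a b] [c d]|r [a b]|[a b]] //=; first by rewrite mul0r subr0.
by rewrite lerDl sqr_ge0.
Qed.

Lemma real_coordinate_Im (R : realType) : real_coordinate (@complex.Im R).
Proof.
split=> [[a b] [c d]|r [a b]|[a b]] //=; first by rewrite mul0r addr0.
by rewrite lerDr sqr_ge0.
Qed.

Lemma real_coordinateB (R : realType) (p : R[i] -> R) : real_coordinate p ->
  forall x y, p (x - y) = p x - p y.
Proof.
move=> [pD pZ _] x y; rewrite pD; congr (_ + _).
have := pZ (- 1) y; rewrite rmorphN1 !mulN1r//.
Qed.

Lemma real_coordinate_mul (R : realType) (p : R[i] -> R) (n : nat)
    (A : 'M[R]_n) (x : 'cV[R[i]]_n) (i : 'I_n) : real_coordinate p ->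
  p ((map_mx (real_complex R) A *m x) i 0) = \sum_j A i j * p (x j 0).
Proof.
move=> [pD pZ _]; rewrite mxE.
have p0 : p 0 = 0 by have := pZ 0 0; rewrite mulr0 mul0r.
rewrite (big_morph p pD p0); apply: eq_bigr => j _; by rewrite mxE pZ.
Qed.

Lemma time_derivative_coordinate (R : realType) (n : nat) (p : R[i] -> R)
    (U V : R -> fourier R n) (k : 'cV[int]_n) (i : 'I_n) :
  real_coordinate p -> time_derivative U V ->
  halfline_derivative (fun t => p (U t k i 0)) (fun t => p (V t k i 0)).
Proof.
move=> pP UV t t0; have := UV k t t0 => H.
have pB := real_coordinateB pP; have [pD pZ ple] := pP.
pose x s := (real_complex R (s - t)^-1 *: (U s k - U t k) - V t k) i 0.
have xE s : (s - t)^-1 * (p (U s k i 0) - p (U t k i 0)) - p (V t k i 0)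
    = p (x s).
  by rewrite /x !mxE pB pZ pB.
under eq_fun do rewrite xE.
have : `|p (x s)| @[s --> within [set s : R | 0 <= s] t^'] --> (0 : R).
  have := cvg_comp _ _ H (@sqrt_continuous R 0); rewrite sqrtr0.
  apply: squeeze_cvgr (cvg_cst (0 : R)); near=> s.
  rewrite normr_ge0/= -sqrtr_sqr ler_wsqrtr//.
  apply: le_trans (ple _) _; rewrite /csqnorm.
  by rewrite (bigD1 i)//= lerDl sumr_ge0// => j _; rewrite addr_ge0 ?sqr_ge0.
by move/norm_cvg0P.
Unshelve. all: by end_near. Qed.

(** Each spectral projection of the difference of two solutions is an
    oscillator started from rest at the origin. *)
Lemma cauchy_solution_unique (R : realType) (n : nat)
    (M : 'cV[int]_n -> 'M[R]_n) (l1 l2 : 'cV[int]_n -> R)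
    (b : fourier R n) (U U' : R -> fourier R n) :
  (forall k, M k = line_perp_mx (intvec R k) (l1 k) (l2 k)) ->
  (forall k, l1 k <= 0) -> (forall k, l2 k <= 0) ->
  cauchy_solution M b U -> cauchy_solution M b U' ->
  forall t : R, 0 <= t -> U t = U' t.
Proof.
move=> ME l1N l2N [V [UV VM U0 V0]] [V' [UV' VM' U0' V0']] t t0.
apply/funext => k.
suff key p : real_coordinate p -> forall i, p (U t k i 0) = p (U' t k i 0).
  apply/matrixP => i j; rewrite ord1.
  have := key _ (@real_coordinate_Re R) i; have := key _ (@real_coordinate_Im R) i.
  by case: (U t k i 0) => a c; case: (U' t k i 0) => a' c' /= -> ->.
move=> pP; have pB := real_coordinateB pP; have [pD pZ _] := pP.
pose w s : 'cV[R]_n := \col_i (p (U s k i 0) - p (U' s k i 0)).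
pose z s : 'cV[R]_n := \col_i (p (V s k i 0) - p (V' s k i 0)).
have dw i : halfline_derivative (fun s => w s i 0) (fun s => z s i 0).
  have := halfline_derivativeD 1 (- 1)
    (time_derivative_coordinate k i pP UV)
    (time_derivative_coordinate k i pP UV').
  by congr halfline_derivative; apply/funext => s;
    rewrite mxE mul1r mulN1r.
have dz i : halfline_derivative (fun s => z s i 0)
    (fun s => (M k *m w s) i 0).
  have := halfline_derivativeD 1 (- 1)
    (time_derivative_coordinate k i pP VM)
    (time_derivative_coordinate k i pP VM').
  congr halfline_derivative; apply/funext => s.
    by rewrite mxE mul1r mulN1r.
  have mulE u : p ((multiplier M u \+ b) k i 0)
      = \sum_j M k i j * p (u k j 0) + p (b k i 0).
    by rewrite /= mxE pD real_coordinate_mul.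
  rewrite !mulE mul1r mulN1r mxE opprD addrACA subrr addr0 -sumrB.
  apply: eq_bigr => j _; by rewrite mxE mulrBr.
have proj (A : 'M[R]_n) l : l <= 0 -> A *m M k = l *: A ->
    A *m w t = 0.
  move=> l0 AM; apply/matrixP => i j; rewrite ord1 [RHS]mxE mxE.
  have dAw := halfline_derivative_sum (A i) dw.
  have dAz := halfline_derivative_sum (A i) dz.
  have AwE s : \sum_j A i j * (M k *m w s) j 0
      = l * \sum_j A i j * w s j 0.
    have : (A *m (M k *m w s)) i 0 = l * (A *m w s) i 0.
      by rewrite mulmxA AM -scalemxAl mxE.
    by rewrite mxE [X in _ = _ * X]mxE.
  apply: (oscillator_unique l0 dAw _ _ _ t0).
  - by have := dAz; congr halfline_derivative; apply/funext => s; rewrite AwE.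
  - by apply: big1 => m _; rewrite mxE U0 U0' subrr mulr0.
  - by apply: big1 => m _; rewrite mxE V0 V0' subrr mulr0.
have w0 : w t = 0.
  pose v := intvec R k.
  have PE : line_proj v = line_perp_mx v 1 0.
    by rewrite /line_perp_mx scale1r scale0r addr0.
  have QE : 1%:M - line_proj v = line_perp_mx v 0 1.
    by rewrite /line_perp_mx scale1r scale0r add0r.
  have PM : line_proj v *m M k = l1 k *: line_proj v.
    rewrite PE ME line_perp_mxM mul1r mul0r /line_perp_mx !scale0r !addr0.
    by rewrite scale1r.
  have QM : (1%:M - line_proj v) *m M k = l2 k *: (1%:M - line_proj v).
    rewrite QE ME line_perp_mxM mul1r mul0r /line_perp_mx !scale0r !add0r.
    by rewrite scale1r.
  rewrite -[w t]mul1mx -[1%:M](subrK (line_proj v)) mulmxDl.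
  by rewrite (proj _ _ (l2N k) QM) (proj _ _ (l1N k) PM) addr0.
move=> i; apply/eqP; rewrite -subr_eq0.
by have /matrixP/(_ i 0) := w0; rewrite !mxE => ->.
Qed.

(** * Dominated convergence for families indexed by a countable set *)

Lemma esum_scale_lty (R : realType) (T : choiceType) (a : T -> R) (C : R) :
  0 <= C -> (forall k, 0 <= a k) ->
  (\esum_(k in [set: T]) (a k)%:E < +oo)%E ->
  (\esum_(k in [set: T]) (C * a k)%:E < +oo)%E.
Proof.
move=> C0 a0 afin.
apply: (@le_lt_trans _ _ (C%:E * \esum_(k in [set: T]) (a k)%:E)%E); last first.
  have -> : (\esum_(k in [set: T]) (a k)%:E =
    (fine (\esum_(k in [set: T]) (a k)%:E))%:E)%E.
    by rewrite fineK// ge0_fin_numE// esum_ge0// => k _; rewrite lee_fin.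
  by rewrite -EFinM ltry.
apply: ge_ereal_sup => _ [X [finX _] <-].
under eq_fsbigr do rewrite EFinM.
rewrite -ge0_mule_fsumr//.
apply: lee_wpmul2l => //.
by apply: ereal_sup_ubound; exists X.
Qed.

Lemma ge0_cvge0 (R : realType) (F : set_system R) (g : R -> \bar R) :
  Filter F -> (forall x, 0 <= g x)%E ->
  (forall e : R, 0 < e -> \forall x \near F, (g x <= e%:E)%E) ->
  g x @[x --> F] --> (0 : R)%:E.
Proof.
move=> FF g0 gle; apply/fine_cvgP; split.
  have := gle 1 ltr01; apply: filterS => x gx.
  by rewrite ge0_fin_numE// (le_lt_trans gx)// ltry.
apply/cvgrPdist_le => e e0; have := gle e e0; apply: filterS => x gx.
rewrite sub0r normrN /= ger0_norm ?fine_ge0//.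
have gfin : g x \is a fin_num by rewrite ge0_fin_numE// (le_lt_trans gx)// ltry.
by rewrite -lee_fin fineK.
Qed.

(** A finite set of indices carries all but [e / 2] of the dominating sum, and
    on that set termwise convergence suffices. *)
Lemma esum_dominated_cvg0 (R : realType) (T : choiceType) (F : set_system R)
    (f : R -> T -> R) (a : T -> R) :
  Filter F -> (forall x k, 0 <= f x k) -> (forall k, 0 <= a k) ->
  (\esum_(k in [set: T]) (a k)%:E < +oo)%E ->
  (\forall x \near F, forall k, f x k <= a k) ->
  (forall k, f x k @[x --> F] --> (0 : R)) ->
  forall e : R, 0 < e ->
    \forall x \near F, (\esum_(k in [set: T]) (f x k)%:E <= e%:E)%E.
Proof.
move=> FF f0 a0 afin fa fcvg e e0.
have aE0 k : (0 <= (a k)%:E)%E by rewrite lee_fin.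
have fE0 x k : (0 <= (f x k)%:E)%E by rewrite lee_fin.
set A := (\esum_(k in [set: T]) (a k)%:E)%E in afin.
have Afin : A \is a fin_num by rewrite ge0_fin_numE// esum_ge0.
have [_ [X [finX _] <-]] : exists2 y : \bar R,
    [set (\sum_(k \in B) (a k)%:E)%E | B in fsets [set: T]] y
    & (A - (e / 2)%:E < y)%E.
  by apply: ereal_sup_gt; rewrite lteBlDr// lteDl// lte_fin divr_gt0.
move=> AX.
have finsum (g : T -> R) : (forall k, 0 <= g k) ->
    (\esum_(k in [set: T] `&` X) (g k)%:E = (\sum_(k \in X) g k)%:E)%E.
  move=> g0; rewrite setTI -fsumEFin// -(set_mem_set X) esum_fset ?set_mem_set//.
  by move=> k _; rewrite lee_fin.
have tail : (\esum_(k in [set: T] `&` ~` X) (a k)%:E <= (e / 2)%:E)%E.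
  have := esumID X [set: T] (fun k => (a k)%:E) (fun k _ => aE0 k).
  rewrite -/A finsum// => AE; move: Afin AX; rewrite fsumEFin// AE.
  set t := \esum_(k in _) _; case: t AE => [t AE _|//|//].
  by rewrite lteBlDr// -!EFinD lte_fin lee_fin; lra.
have fsum0 : \sum_(k \in X) f x k @[x --> F] --> (0 : R).
  have -> : (fun x => \sum_(k \in X) f x k)
      = (fun x => \sum_(k <- finmap.enum_fset (fset_set X)) f x k).
    by apply/funext => x; rewrite fsbig_finite.
  have : \sum_(k <- finmap.enum_fset (fset_set X)) f x k @[x --> F] -->
      \sum_(k <- finmap.enum_fset (fset_set X)) (0 : R).
    apply: (@cvg_big R _ +%R 0 xpredT) => [|k _]; last exact: fcvg.
    exact: add_continuous.
  by rewrite big1.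
have e2 : 0 < e / 2 by rewrite divr_gt0.
have /cvgrPdist_le/(_ _ e2) := fsum0.
move=> /(filterI fa); apply: filterS => x [fax].
rewrite sub0r normrN => /(le_trans (ler_norm _)) fX.
rewrite (esumID X); last by move=> k _; exact: fE0.
rewrite finsum// [e in leRHS]splitr EFinD; apply: leeD; first by rewrite lee_fin.
by apply: le_trans tail; apply: le_esum => k _; rewrite lee_fin.
Qed.

Lemma sqrte_lty (R : realType) (x : \bar R) : ((sqrte x < +oo) = (x < +oo))%E.
Proof. by case: x => [x||]; rewrite !ltey. Qed.

Lemma csqnorm_ge0 (R : realType) (n : nat) (x : 'cV[R[i]]_n) : 0 <= csqnorm x.
Proof. by apply: sumr_ge0 => i _; rewrite addr_ge0 ?sqr_ge0. Qed.

Lemma Hspace_dominated (R : realType) (n : nat) (S q C : R)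
    (b g : fourier R n) : 0 <= C -> Hspace S b ->
  (forall k, (1 + sqnorm (intvec R k)) `^ q * csqnorm (g k)
     <= C * ((1 + sqnorm (intvec R k)) `^ S * csqnorm (b k))) ->
  Hspace q g.
Proof.
move=> C0 hb gb.
have csq0 := @csqnorm_ge0 R n.
move: hb; rewrite /Hspace /Hnorm /= !sqrte_lty => hb.
apply: (@le_lt_trans _ _ (\esum_(k in [set: 'cV[int]_n])
    (C * ((1 + sqnorm (intvec R k)) `^ S * csqnorm (b k)))%:E)%E).
  by apply: le_esum => k _; rewrite lee_fin.
by apply: esum_scale_lty => // k; rewrite mulr_ge0 ?powR_ge0.
Qed.

Lemma Hnorm_dominated_cvg0 (R : realType) (n : nat) (F : set_system R)
    (S q C : R) (b : fourier R n) (g : R -> fourier R n) :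
  Filter F -> 0 <= C -> Hspace S b ->
  (\forall x \near F, forall k,
     (1 + sqnorm (intvec R k)) `^ q * csqnorm (g x k)
       <= C * ((1 + sqnorm (intvec R k)) `^ S * csqnorm (b k))) ->
  (forall k, csqnorm (g x k) @[x --> F] --> (0 : R)) ->
  Hnorm q (g x) @[x --> F] --> (0 : R)%:E.
Proof.
move=> FF C0 hb gb gcvg; apply: ge0_cvge0 => [x|e e0]; first exact: sqrte_ge0.
have csq0 := @csqnorm_ge0 R n.
move: hb; rewrite /Hspace /Hnorm /= sqrte_lty => hb.
have w0 (p : R) (k : 'cV[int]_n) : 0 <= (1 + sqnorm (intvec R k)) `^ p.
  exact: powR_ge0.
have e20 : 0 < e ^+ 2 by rewrite exprn_gt0.
have key : \forall x \near F, (\esum_(k in [set: 'cV[int]_n])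
    ((1 + sqnorm (intvec R k)) `^ q * csqnorm (g x k))%:E <= (e ^+ 2)%:E)%E.
  apply: (esum_dominated_cvg0 (a := fun k =>
    C * ((1 + sqnorm (intvec R k)) `^ S * csqnorm (b k)))) => //.
  - by move=> x k; rewrite mulr_ge0.
  - by move=> k; rewrite !mulr_ge0.
  - by apply: esum_scale_lty => // k; rewrite mulr_ge0.
  - move=> k; rewrite -[X in _ --> X](mulr0 ((1 + sqnorm (intvec R k)) `^ q)).
    by apply: cvgM => //; exact: cvg_cst.
apply: filterS key => x le_e; rewrite -[e%:E]gee0_abs ?lee_fin ?(ltW e0)//.
by rewrite -sqrte_sqr -EFin_expe lee_sqrt// lee_fin ltW.
Qed.

(** * The explicit solution in Sobolev norms *)

(** The spectral factor of the explicit solution on an eigenspace of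
    eigenvalue [l]. *)
Definition time_factor (R : realType) (l t : R) : R :=
  (cos (Num.sqrt (- l) * t) - 1) / l.

Lemma one_minus_cos_le (R : realType) (x : R) :
  0 <= x -> 1 - cos x <= x ^+ 2 / 2.
Proof.
move=> x0.
have sin_le (y : R) : 0 <= y -> sin y <= y.
  move=> y0; have := @nondecreasing_ray _ (fun y => y - sin y)
    (fun y => 1 - cos y) 0 y y0.
  rewrite sin0 subr0 subr_ge0; apply=> z z0.
  by rewrite subr_ge0 cos_le1.
have := @nondecreasing_ray _ (fun y => y ^+ 2 / 2 + cos y)
  (fun y => y - sin y) 0 x x0.
rewrite cos0 expr0n/= mul0r add0r => H.
suff : 1 <= x ^+ 2 / 2 + cos x by lra.
apply: H => [z z0|z z0]; last by rewrite subr_ge0 sin_le.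
by apply: is_derive_eq; rewrite /GRing.scale/=; field.
Qed.

Lemma time_factor_le_time (R : realType) (l t : R) : l < 0 -> 0 <= t ->
  time_factor l t ^+ 2 <= (t ^+ 2 / 2) ^+ 2.
Proof.
move=> l0 t0; have l0' : 0 < - l by rewrite oppr_gt0.
have -> : time_factor l t = (1 - cos (Num.sqrt (- l) * t)) / (- l).
  by rewrite /time_factor invrN mulrN -mulNr opprB.
have := one_minus_cos_le (mulr_ge0 (sqrtr_ge0 (- l)) t0).
rewrite exprMn sqr_sqrtr ?(ltW l0')// => H.
rewrite lerXn2r ?nnegrE ?divr_ge0 ?exprn_ge0 ?subr_ge0 ?cos_le1 ?(ltW l0')//.
by rewrite ler_pdivrMr// (le_trans H)//; lra.
Qed.

(** The cosine is bounded, so the factor decays like the inverse of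
    the eigenvalue. *)
Lemma time_factor_weight (R : realType) (l t d w p : R) : l < 0 -> 0 < d ->
  0 < w -> d * w `^ p <= - l ->
  w `^ (2 * p) * time_factor l t ^+ 2 <= 4 / d ^+ 2.
Proof.
move=> l0 d0 w0 dw; have wp : 0 < w `^ p by rewrite powR_gt0.
have -> : 2 * p = p + p by ring.
rewrite powRD ?(gt_eqF w0) ?implybT// -expr2 -exprMn.
rewrite -[4]/(4%:R) (_ : 4%:R = 2 ^+ 2 :> R); last by ring.
rewrite -expr_div_n -[leLHS]real_normK ?num_real//.
rewrite lerXn2r ?nnegrE ?divr_ge0 ?(ltW d0)//.
rewrite ler_pdivlMr// normrM (gtr0_norm wp) /time_factor normrM normfV.
rewrite (ltr0_norm l0) mulrA mulrAC ler_pdivrMr ?oppr_gt0//.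
have c2 : `|cos (Num.sqrt (- l) * t) - 1| <= 2.
  by have := cos_max (Num.sqrt (- l) * t); rewrite !ler_norml; lra.
rewrite mulrAC [_ * d]mulrC [leRHS]mulrC ler_pM// mulr_ge0// ltW//.
Qed.

Lemma time_factor_cvg (R : realType) (F : set_system R) (l : R -> R) (m t : R) :
  Filter F -> l x @[x --> F] --> m -> m < 0 ->
  time_factor (l x) t @[x --> F] --> time_factor m t.
Proof.
move=> FF lm m0.
have cs : Num.sqrt (- l x) * t @[x --> F] --> Num.sqrt (- m) * t.
  apply: cvgM; last exact: cvg_cst.
  apply: (@continuous_cvg _ _ _ _ _ _ Num.sqrt); first exact: sqrt_continuous.
  exact: cvgN.
have cc : cos (Num.sqrt (- l x) * t) @[x --> F] --> cos (Num.sqrt (- m) * t).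
  by apply: (@continuous_cvg _ _ _ _ _ _ cos) => //; exact: continuous_cos.
apply: cvgM; last by apply: cvgV => //; rewrite lt_eqF.
exact: (cvgB cc (cvg_cst (1 : R))).
Qed.

Lemma sqnorm_ge0 (R : realType) (n : nat) (v : 'cV[R]_n) : 0 <= sqnorm v.
Proof. by apply: sumr_ge0 => i _; exact: sqr_ge0. Qed.

(** Some coordinate is a nonzero integer. *)
Lemma sqnorm_intvec_ge1 (R : realType) (n : nat) (k : 'cV[int]_n) :
  k != 0 -> 1 <= sqnorm (intvec R k).
Proof.
move=> k0; have [i ki] : exists i, k i 0 != 0.
  apply/existsP; apply: contraNT k0; rewrite negb_exists => /forallP h.
  by apply/eqP/matrixP => i j; rewrite ord1 mxE; have := h i; rewrite negbK => /eqP.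
rewrite /sqnorm (bigD1 i)//= ler_wpDr ?sumr_ge0//.
  by move=> j _; exact: sqr_ge0.
rewrite mxE -real_normK ?num_real// -intr_norm; apply: exprn_ege1.
by rewrite -[1]/(1%:~R) ler_int -gtz0_ge1 normr_gt0.
Qed.

Lemma csqnormE (R : realType) (n : nat) (x : 'cV[R[i]]_n) :
  csqnorm x = sqnorm (map_mx (@complex.Re R) x)
            + sqnorm (map_mx (@complex.Im R) x).
Proof.
rewrite /csqnorm /sqnorm -big_split; apply: eq_bigr => i _ /=.
by rewrite !mxE.
Qed.

Lemma sqnorm_line_perp (R : realType) (n : nat) (v x : 'cV[R]_n) (p q : R) :
  sqnorm (line_perp_mx v p q *m x) <= (p ^+ 2 + q ^+ 2) * sqnorm x.
Proof.
pose s (B : 'M[R]_n) := (x^T *m B *m x) 0 0.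
have sE (A : 'M[R]_n) : sqnorm (A *m x) = s (A^T *m A).
  have /matrixP/(_ 0 0) := sqnormE (A *m x).
  by rewrite trmx_mul [in RHS]mxE eqxx mulr1n => <-; rewrite /s !mulmxA.
have tr p' q' : (line_perp_mx v p' q')^T = line_perp_mx v p' q'.
  have tP : (line_proj v)^T = line_proj v.
    by rewrite /line_proj linearZ/= trmx_mul trmxK.
  rewrite /line_perp_mx; move: (line_proj v) tP => P tP.
  by rewrite raddfD/= !linearZ/= raddfB/= trmx1 tP.
have sL a b : s (line_perp_mx v a b)
    = a * s (line_perp_mx v 1 0) + b * s (line_perp_mx v 0 1).
  rewrite /s /line_perp_mx !scale1r !scale0r addr0 add0r.
  move: (line_proj v) (1%:M - line_proj v) => P Q.
  rewrite mulmxDr mulmxDl -!scalemxAr -!scalemxAl [LHS]mxE.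
  by congr (_ + _); rewrite [LHS]mxE.
have s0 a b : 0 <= s (line_perp_mx v (a * a) (b * b)).
  by rewrite -line_perp_mxM -{1}tr -sE sqnorm_ge0.
have sP := s0 1 0; have sQ := s0 0 1; rewrite mulr1 mulr0 in sP sQ.
have xE : sqnorm x = s (line_perp_mx v 1 0) + s (line_perp_mx v 0 1).
  have := sE 1%:M; rewrite mul1mx trmx1 mul1mx -(line_perp_mx1 v) sL.
  by rewrite !mul1r.
rewrite sE tr line_perp_mxM sL xE -!expr2 mulrDr.
by apply: lerD; rewrite ler_wpM2r// ?lerDl ?lerDr sqr_ge0.
Qed.

Lemma csqnorm_line_perp (R : realType) (n : nat) (v : 'cV[R]_n)
    (x : 'cV[R[i]]_n) (p q : R) :
  csqnorm (map_mx (real_complex R) (line_perp_mx v p q) *m x)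
    <= (p ^+ 2 + q ^+ 2) * csqnorm x.
Proof.
have E r : real_coordinate r ->
    map_mx r (map_mx (real_complex R) (line_perp_mx v p q) *m x)
      = line_perp_mx v p q *m map_mx r x.
  move=> hr; apply/matrixP => i j; rewrite ord1 mxE real_coordinate_mul// mxE.
  by apply: eq_bigr => m _; congr (_ * _); rewrite mxE.
rewrite !csqnormE (E _ (@real_coordinate_Re R)) (E _ (@real_coordinate_Im R)).
by rewrite mulrDr lerD// sqnorm_line_perp.
Qed.

Lemma csqnormZ (R : realType) (n : nat) (r : R) (x : 'cV[R[i]]_n) :
  csqnorm (real_complex R r *: x) = r ^+ 2 * csqnorm x.
Proof.
rewrite /csqnorm mulr_sumr; apply: eq_bigr => i _; rewrite mxE.
by case: (x i 0) => a b /=; rewrite !mul0r subr0 addr0 !exprMn mulrDr.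
Qed.

(** The weight [p] is the number of derivatives gained over the data; the term
    in [t] alone accounts for the zero mode. *)
Lemma explicit_solution_bound (R : realType) (n : nat)
    (l1 l2 : 'cV[int]_n -> R) (b : fourier R n) (t S p C1 C2 : R) :
  0 <= C1 -> 0 <= C2 ->
  (forall k, k != 0 -> (1 + sqnorm (intvec R k)) `^ p
     * time_factor (l1 k) t ^+ 2 <= C1) ->
  (forall k, k != 0 -> (1 + sqnorm (intvec R k)) `^ p
     * time_factor (l2 k) t ^+ 2 <= C2) ->
  forall k, (1 + sqnorm (intvec R k)) `^ (S + p)
      * csqnorm (explicit_solution l1 l2 b t k)
    <= ((t ^+ 2 / 2) ^+ 2 + C1 + C2)
      * ((1 + sqnorm (intvec R k)) `^ S * csqnorm (b k)).
Proof.
move=> C10 C20 h1 h2 k; have b0 := csqnorm_ge0 (b k).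
have w0 : 0 < 1 + sqnorm (intvec R k) by rewrite ltr_wpDr ?sqnorm_ge0.
have t0 := sqr_ge0 (t ^+ 2 / 2).
have H0 : 0 <= (1 + sqnorm (intvec R k)) `^ S * csqnorm (b k).
  by rewrite mulr_ge0 ?powR_ge0.
rewrite /explicit_solution; case: eqVneq => [k0|k0].
  have sq0 : sqnorm (intvec R k) = 0.
    by apply/eqP; rewrite sqnorm_eq0 intvec_eq0 k0.
  rewrite k0 -k0 sq0 addr0 !powR1 !mul1r csqnormZ ler_wpM2r//; lra.
rewrite powRD ?(gt_eqF w0) ?implybT// -mulrA [leRHS]mulrCA.
rewrite ler_wpM2l ?powR_ge0//.
apply: le_trans (ler_wpM2l (powR_ge0 _ _) (csqnorm_line_perp _ _ _ _)) _.
rewrite mulrA ler_wpM2r// mulrDr.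
have := h1 k k0; have := h2 k k0; rewrite /time_factor; lra.
Qed.

Lemma explicit_solution_cvg (R : realType) (n : nat) (F : set_system R)
    (l1 l2 : R -> 'cV[int]_n -> R) (m1 m2 : 'cV[int]_n -> R)
    (b : fourier R n) (t : R) : Filter F ->
  (forall k, k != 0 -> time_factor (l1 x k) t @[x --> F]
     --> time_factor (m1 k) t) ->
  (forall k, k != 0 -> time_factor (l2 x k) t @[x --> F]
     --> time_factor (m2 k) t) ->
  forall k, csqnorm (explicit_solution (l1 x) (l2 x) b t k
     - explicit_solution m1 m2 b t k) @[x --> F] --> (0 : R).
Proof.
move=> FF h1 h2 k; rewrite /explicit_solution; case: (eqVneq k 0) => [k0|k0].
  under eq_fun do rewrite subrr.
  rewrite /csqnorm big1; first exact: cvg_cst.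
  by move=> i _; rewrite mxE /= expr0n addr0.
have d1 : time_factor (l1 x k) t - time_factor (m1 k) t @[x --> F] --> (0 : R).
  by rewrite -(subrr (time_factor (m1 k) t)); apply: cvgB (h1 k k0) (cvg_cst _).
have d2 : time_factor (l2 x k) t - time_factor (m2 k) t @[x --> F] --> (0 : R).
  by rewrite -(subrr (time_factor (m2 k) t)); apply: cvgB (h2 k k0) (cvg_cst _).
pose e1 x := time_factor (l1 x k) t - time_factor (m1 k) t.
pose e2 x := time_factor (l2 x k) t - time_factor (m2 k) t.
have up : (e1 x * e1 x + e2 x * e2 x) * csqnorm (b k)
    @[x --> F] --> (0 * 0 + 0 * 0) * csqnorm (b k).
  by apply: cvgM; [apply: cvgD; exact: cvgM|exact: cvg_cst].
rewrite mulr0 addr0 mul0r in up.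
apply: squeeze_cvgr (cvg_cst (0 : R)) up; near=> x.
rewrite csqnorm_ge0/= -mulmxBl -map_mxB.
have -> (v : 'cV[R]_n) : line_perp_mx v ((cos (Num.sqrt (- l1 x k) * t) - 1) / l1 x k)
      ((cos (Num.sqrt (- l2 x k) * t) - 1) / l2 x k)
    - line_perp_mx v ((cos (Num.sqrt (- m1 k) * t) - 1) / m1 k)
      ((cos (Num.sqrt (- m2 k) * t) - 1) / m2 k)
    = line_perp_mx v (e1 x) (e2 x).
  by rewrite /line_perp_mx opprD addrACA -!scalerBl.
by rewrite -!expr2; exact: csqnorm_line_perp.
Unshelve. all: by end_near. Qed.

(** * The vanishing-horizon limit *)

(** Every point of the half-line is of the form [|nu| ^ 2 delta ^ 2 / 4], so
    negativity of a multiplier is positivity of its profile. *)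
Lemma profile_gt0 (R : realType) (n : nat) (L : R -> 'cV[R]_n -> R)
    (g : R -> R) : (0 < n)%N ->
  (forall delta nu, L delta nu
     = - (sqnorm nu * g (sqnorm nu * (delta ^+ 2 / 4)))) ->
  (forall delta nu, 0 < delta -> nu != 0 -> L delta nu < 0) ->
  forall w, 0 < w -> 0 < g w.
Proof.
move=> n0 LE L0 w w0; pose nu : 'cV[R]_n := delta_mx (Ordinal n0) 0.
have nu1 : sqnorm nu = 1.
  rewrite /sqnorm (bigD1 (Ordinal n0))//= big1 => [|i i0].
    by rewrite mxE !eqxx expr1n addr0.
  by rewrite mxE (negbTE i0) expr0n.
have nu0 : nu != 0 by rewrite -sqnorm_eq0 nu1 oner_eq0.
have d0 : 0 < 2 * Num.sqrt w by rewrite mulr_gt0 ?sqrtr_gt0.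
have := L0 _ _ d0 nu0; rewrite LE nu1 !mul1r oppr_lt0.
rewrite exprMn sqr_sqrtr ?(ltW w0)//.
by have -> : 2 ^+ 2 * w / 4 = w by field.
Qed.

(** The lower bound is uniform over bounded ranges of [delta], as dominated
    convergence requires. *)
Lemma multiplier_growth (R : realType) (n : nat) (L : R -> 'cV[R]_n -> R)
    (g : R -> R) (a W d : R) : (0 < n)%N ->
  (forall delta nu, L delta nu
     = - (sqnorm nu * g (sqnorm nu * (delta ^+ 2 / 4)))) ->
  (forall delta nu, 0 < delta -> nu != 0 -> L delta nu < 0) ->
  continuous g -> 0 < g 0 -> 0 < a -> 0 <= W -> 0 < d ->
  (forall w, W <= w -> d <= w `^ a * g w) ->
  exists2 K : R, 0 < K & forall delta nu, 0 < delta -> 1 <= sqnorm nu ->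
    K * (1 + delta ^+ 2 / 4) `^ (- a) * (1 + sqnorm nu) `^ (1 - a)
      <= - L delta nu.
Proof.
move=> n0 LE L0 cg g0 a0 W0 d0 gW.
have gpos w : 0 <= w -> 0 < g w.
  by rewrite le_eqVlt => /predU1P[<-//|]; exact: profile_gt0 LE L0 w.
have [K K0 KP] := ray_lower_bound a0 W0 d0 cg gpos gW.
exists (K / 2); first by rewrite divr_gt0.
move=> delta nu delta0 nu1; rewrite LE opprK.
by apply: symbol_lower_bound => //; rewrite divr_ge0 ?sqr_ge0.
Qed.

(** For [beta <= n] the time alone bounds the factors, for [beta > n] the growth
    of the multipliers gains [beta - n] derivatives. *)
Lemma time_factor_bound (R : realType) (n : nat) (L : R -> 'cV[R]_n -> R)
    (beta delta0 t : R) :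
  0 <= t ->
  (forall delta nu, 0 < delta -> nu != 0 -> L delta nu < 0) ->
  (n%:R < beta -> exists2 K : R, 0 < K &
    forall delta nu, 0 < delta -> 1 <= sqnorm nu ->
    K * (1 + delta ^+ 2 / 4) `^ (- ((n%:R + 2 - beta) / 2))
      * (1 + sqnorm nu) `^ (1 - (n%:R + 2 - beta) / 2) <= - L delta nu) ->
  beta < n%:R + 2 ->
  exists2 C : R, 0 <= C & forall delta (k : 'cV[int]_n),
    0 < delta <= delta0 -> k != 0 ->
    (1 + sqnorm (intvec R k)) `^ (Num.max 0 (beta - n%:R))
      * time_factor (L delta (intvec R k)) t ^+ 2 <= C.
Proof.
move=> t0 L0 LK b2; have [bn|nb] := leP beta n%:R.
  have -> : Num.max 0 (beta - n%:R) = 0 by apply/max_idPl; rewrite subr_le0.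
  exists ((t ^+ 2 / 2) ^+ 2); first exact: sqr_ge0.
  move=> delta k /andP[d0 _] k0; rewrite powRr0 mul1r.
  by apply: time_factor_le_time => //; rewrite L0 ?intvec_eq0.
have [K K0 KP] := LK nb.
have -> : Num.max 0 (beta - n%:R) = 2 * (1 - (n%:R + 2 - beta) / 2).
  have -> : 2 * (1 - (n%:R + 2 - beta) / 2) = beta - n%:R by field.
  by apply/max_idPr; rewrite subr_ge0 ltW.
have a0 : 0 < (n%:R + 2 - beta) / 2 by lra.
set a := (n%:R + 2 - beta) / 2 in a0 KP *.
have h0 : 0 < 1 + delta0 ^+ 2 / 4.
  by rewrite ltr_wpDr// divr_ge0 ?sqr_ge0.
pose D := K * (1 + delta0 ^+ 2 / 4) `^ (- a).
have D0 : 0 < D by rewrite mulr_gt0 ?powR_gt0.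
exists (4 / D ^+ 2); first by rewrite divr_ge0 ?sqr_ge0.
move=> delta k /andP[d0 dd] k0.
have k1 := sqnorm_intvec_ge1 R k0.
apply: time_factor_weight => //; first by rewrite L0 ?intvec_eq0.
  by lra.
apply: le_trans (KP delta _ d0 k1); rewrite ler_wpM2r ?powR_ge0//.
rewrite ler_wpM2l ?(ltW K0)// !powRN.
have h1 : 0 < 1 + delta ^+ 2 / 4 by rewrite ltr_wpDr// divr_ge0 ?sqr_ge0.
rewrite lef_pV2 ?posrE ?powR_gt0//; apply: ge0_ler_powR.
- exact: ltW.
- by rewrite nnegrE ltW.
- by rewrite nnegrE ltW.
by rewrite lerD2l ler_pM2r// lerXn2r ?nnegrE//; lra.
Qed.

Lemma multiplier_cvg (R : realType) (n : nat) (L : R -> 'cV[R]_n -> R)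
    (g : R -> R) (nu : 'cV[R]_n) :
  (forall delta nu, L delta nu
     = - (sqnorm nu * g (sqnorm nu * (delta ^+ 2 / 4)))) ->
  continuous g ->
  L delta nu @[delta --> (0 : R)^'+] --> - (sqnorm nu * g 0).
Proof.
move=> LE cg; under eq_fun do rewrite LE.
have d0 : (fun x : R => x) @ (0 : R)^'+ --> (0 : R).
  by apply: cvg_within_filter; exact: cvg_id.
have w0 : sqnorm nu * (delta * delta / 4) @[delta --> (0 : R)^'+]
    --> sqnorm nu * (0 * 0 / 4).
  apply: cvgM; first exact: cvg_cst.
  by apply: cvgM; [exact: cvgM|exact: cvg_cst].
rewrite mul0r mul0r mulr0 in w0.
apply: cvgN; apply: cvgM; first exact: cvg_cst.
under eq_fun do rewrite expr2.
by apply: (@continuous_cvg _ _ _ _ _ _ g) w0; exact: cg.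
Qed.

Lemma csqnormB (R : realType) (n : nat) (x y : 'cV[R[i]]_n) :
  csqnorm (x - y) <= 2 * csqnorm x + 2 * csqnorm y.
Proof.
rewrite /csqnorm !mulr_sumr -big_split; apply: ler_sum => i _ /=.
rewrite !mxE; case: (x i 0) => a b; case: (y i 0) => c d /=.
have := sqr_ge0 (a + c); have := sqr_ge0 (b + d).
by rewrite !expr2; lra.
Qed.

Theorem theorem28 (R : realType) (n : nat) (mu lam beta S : R)
    (b : fourier R n) (U : R -> R -> fourier R n) (UN : R -> fourier R n) :
  (0 < n)%N ->
  beta < n%:R + 2 ->
  0 < mu ->
  0 < lam + 2 * mu ->
  (forall (delta : R) (nu : 'cV[R]_n), 0 < delta -> nu != 0 ->
     lambda1 mu lam delta beta nu < 0) ->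
  (forall (delta : R) (nu : 'cV[R]_n), 0 < delta -> nu != 0 ->
     lambda2 mu delta beta nu < 0) ->
  Hspace S b ->
  (forall delta : R, 0 < delta ->
     cauchy_solution (perimx mu lam delta beta) b (U delta)) ->
  cauchy_solution (naviermx mu lam) b UN ->
  let s' := S + Num.max 0 (beta - n%:R) in
  [/\ forall delta t : R, 0 < delta -> 0 <= t -> Hspace s' (U delta t),
      forall t : R, 0 <= t -> Hspace (S + 2) (UN t)
    & forall t : R, 0 <= t ->
        Hnorm s' (U delta t \- UN t) @[delta --> (0 : R)^'+] --> (0 : R)%:E].
Proof.
move=> n0 bn mu0 lam0 L1 L2 hb solU solN s'.
have n1 : 1 <= n%:R :> R by rewrite ler1n.
pose a : R := (n%:R + 2 - beta) / 2; pose c : R := (n%:R + 4) / 2.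
have a0 : 0 < a by rewrite /a; lra.
have c2 : 5 / 2 <= c by rewrite /c; lra.
have c1 : 1 < c by lra.
have c0 : 0 < c by lra.
have E1 delta nu := @lambda1E R n mu lam delta beta nu bn.
have E2 delta nu := @lambda2E R n mu delta beta nu bn.
rewrite -/a -/c in E1 E2.
have cont1 := @continuous_profile1 R a c mu lam a0 c1.
have cont2 := @continuous_profile2 R a c mu a0 c0.
have p1 := @profile1_at0 R a c mu lam a0 c1.
have p2 := @profile2_at0 R a c mu a0 c0.
have pos2 : 0 < profile2 a c mu 1 by exact: profile_gt0 n0 E2 L2 1 ltr01.
have G1 : n%:R < beta -> exists2 K : R, 0 < K &
    forall delta (nu : 'cV[R]_n), 0 < delta -> 1 <= sqnorm nu ->
    K * (1 + delta ^+ 2 / 4) `^ (- a) * (1 + sqnorm nu) `^ (1 - a)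
      <= - lambda1 mu lam delta beta nu.
  move=> nb; have a1 : 0 < a < 1 by rewrite a0 /a; lra.
  have [W [d [W1 d0 WP]]] := profile1_growth lam a1 c2 mu0 pos2.
  have W0 : 0 <= W by lra.
  by apply: (multiplier_growth n0 E1 L1 cont1 _ a0 W0 d0 WP); rewrite p1.
have G2 : n%:R < beta -> exists2 K : R, 0 < K &
    forall delta (nu : 'cV[R]_n), 0 < delta -> 1 <= sqnorm nu ->
    K * (1 + delta ^+ 2 / 4) `^ (- a) * (1 + sqnorm nu) `^ (1 - a)
      <= - lambda2 mu delta beta nu.
  move=> nb; have c32 : 3 / 2 <= c by lra.
  have WP (w : R) : 1 <= w -> profile2 a c mu 1 <= w `^ a * profile2 a c mu w.
    exact: profile2_growth.
  by apply: (multiplier_growth n0 E2 L2 cont2 _ a0 ler01 pos2 WP); rewrite p2.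
pose l1 delta (k : 'cV[int]_n) := lambda1 mu lam delta beta (intvec R k).
pose l2 delta (k : 'cV[int]_n) := lambda2 mu delta beta (intvec R k).
pose m1 (k : 'cV[int]_n) := - (lam + 2 * mu) * sqnorm (intvec R k).
pose m2 (k : 'cV[int]_n) := - mu * sqnorm (intvec R k).
have sq0 : sqnorm (intvec R (0 : 'cV[int]_n)) = 0.
  by apply/eqP; rewrite sqnorm_eq0 intvec_eq0.
have l1N delta k : 0 < delta -> k != 0 -> l1 delta k < 0.
  by move=> d0 k0; apply: L1; rewrite ?intvec_eq0.
have l2N delta k : 0 < delta -> k != 0 -> l2 delta k < 0.
  by move=> d0 k0; apply: L2; rewrite ?intvec_eq0.
have m1N k : k != 0 -> m1 k < 0.
  move=> /(sqnorm_intvec_ge1 R) k1; rewrite /m1 mulNr oppr_lt0 mulr_gt0//; lra.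
have m2N k : k != 0 -> m2 k < 0.
  move=> /(sqnorm_intvec_ge1 R) k1; rewrite /m2 mulNr oppr_lt0 mulr_gt0//; lra.
(* Uniqueness turns the arbitrary solutions into the explicit ones. *)
have UE delta t : 0 < delta -> 0 <= t ->
    U delta t = explicit_solution (l1 delta) (l2 delta) b t.
  move=> d0.
  have le0 (l : 'cV[int]_n -> R) :
    l 0 = 0 -> (forall k, k != 0 -> l k < 0) -> forall k, l k <= 0.
    by move=> l0 ln k; have [->|/ln/ltW//] := eqVneq k 0; rewrite l0.
  have l10 : l1 delta 0 = 0 by rewrite /l1 E1 sq0 mul0r oppr0.
  have l20 : l2 delta 0 = 0 by rewrite /l2 E2 sq0 mul0r oppr0.
  apply: (cauchy_solution_unique (l1 := l1 delta) (l2 := l2 delta) _ _ _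
    (solU delta d0)).
  - move=> k; rewrite /perimx; case: eqVneq => // ->.
    by rewrite /line_perp_mx l10 l20 !scale0r addr0.
  - by apply: le0 => // k; exact: l1N.
  - by apply: le0 => // k; exact: l2N.
  apply: explicit_solutionP => [|k k0|k|k].
  - by rewrite /perimx eqxx.
  - by rewrite /perimx (negbTE k0).
  - exact: l1N.
  - exact: l2N.
have UNE t : 0 <= t -> UN t = explicit_solution m1 m2 b t.
  have nonpos (r : R) k : 0 < r -> - r * sqnorm (intvec R k) <= 0 :> R.
    by move=> r0; rewrite mulNr oppr_le0 mulr_ge0 ?sqnorm_ge0 ?ltW.
  apply: (cauchy_solution_unique (l1 := m1) (l2 := m2) _ _ _ solN).
  - by move=> k; rewrite naviermxE.
  - by move=> k; exact: nonpos.
  - by move=> k; exact: nonpos.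
  apply: explicit_solutionP => // [|k k0]; last by rewrite naviermxE.
  by rewrite naviermxE sq0 !mulr0 /line_perp_mx !scale0r addr0.
(* With delta0 = delta this bound gives the membership in the Sobolev space,
   and with delta0 = 1 the domination. *)
have boundU delta0 t : 0 <= t -> exists2 C : R, 0 <= C &
    forall delta k, 0 < delta <= delta0 ->
    (1 + sqnorm (intvec R k)) `^ s' * csqnorm (U delta t k)
      <= C * ((1 + sqnorm (intvec R k)) `^ S * csqnorm (b k)).
  move=> t0.
  have [C1 C10 H1] := time_factor_bound delta0 t0 L1 G1 bn.
  have [C2 C20 H2] := time_factor_bound delta0 t0 L2 G2 bn.
  exists ((t ^+ 2 / 2) ^+ 2 + C1 + C2); first by rewrite !addr_ge0 ?sqr_ge0.
  move=> delta k d0; rewrite UE//; last by case/andP: d0.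
  by apply: explicit_solution_bound => // j j0; [exact: H1|exact: H2].
have boundN (p t : R) : p <= 2 -> exists2 C : R, 0 <= C & forall k, 0 <= t ->
    (1 + sqnorm (intvec R k)) `^ (S + p) * csqnorm (UN t k)
      <= C * ((1 + sqnorm (intvec R k)) `^ S * csqnorm (b k)).
  move=> p2'.
  have factor (r : R) k : 0 < r -> k != 0 -> (1 + sqnorm (intvec R k)) `^ p
      * time_factor (- r * sqnorm (intvec R k)) t ^+ 2 <= 4 / (r / 2) ^+ 2.
    move=> r0 /(sqnorm_intvec_ge1 R) k1.
    apply: (@le_trans _ _ ((1 + sqnorm (intvec R k)) `^ (2 * 1)
      * time_factor (- r * sqnorm (intvec R k)) t ^+ 2)).
      by rewrite ler_wpM2r ?sqr_ge0// ler_powR ?mulr1//; lra.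
    apply: time_factor_weight; rewrite ?divr_gt0//.
    - by rewrite mulNr oppr_lt0 mulr_gt0//; lra.
    - by lra.
    - by rewrite powRr1; [nra|lra].
  exists ((t ^+ 2 / 2) ^+ 2 + 4 / ((lam + 2 * mu) / 2) ^+ 2
    + 4 / (mu / 2) ^+ 2).
    by rewrite !addr_ge0 ?divr_ge0 ?sqr_ge0.
  move=> k t0; rewrite UNE//.
  by apply: explicit_solution_bound => [||j j0|j j0];
    rewrite ?divr_ge0 ?sqr_ge0//; exact: factor.
split=> [delta t d0 t0|t t0|t t0].
- have [C C0 H] := boundU delta t t0; apply: (Hspace_dominated C0 hb) => k.
  by apply: H; rewrite d0 lexx.
- have [C C0 H] := boundN 2 t (lexx _); apply: (Hspace_dominated C0 hb) => k.
  exact: H.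
have [C C0 HU] := boundU 1 t t0.
have [|D D0 HN] := boundN (Num.max 0 (beta - n%:R)) t.
  by rewrite ge_max; apply/andP; split; lra.
apply: (Hnorm_dominated_cvg0 (C := 2 * C + 2 * D) (S := S) (b := b)) => //.
- by rewrite addr_ge0 ?mulr_ge0.
- near=> delta.
  have d01 : 0 < delta <= 1.
    apply/andP; split; near: delta; first exact: nbhs_right_gt.
    exact: nbhs_right_le.
  move=> k.
  apply: le_trans (ler_wpM2l (powR_ge0 _ _) (csqnormB _ _)) _.
  have := HU delta k d01; have := HN k t0; rewrite -/s' => h1 h2.
  by lra.
- have cv := @explicit_solution_cvg R n (0 : R)^'+ l1 l2 m1 m2 b t.
  move=> k.
  have f1 j : j != 0 -> time_factor (l1 delta j) t @[delta --> (0 : R)^'+]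
      --> time_factor (m1 j) t.
    move=> j0; apply: time_factor_cvg (m1N j j0).
    have := multiplier_cvg (nu := intvec R j) E1 cont1.
    by rewrite p1 mulrC -mulNr.
  have f2 j : j != 0 -> time_factor (l2 delta j) t @[delta --> (0 : R)^'+]
      --> time_factor (m2 j) t.
    move=> j0; apply: time_factor_cvg (m2N j j0).
    have := multiplier_cvg (nu := intvec R j) E2 cont2.
    by rewrite p2 mulrC -mulNr.
  apply: cvg_trans (cv _ f1 f2 k); apply: near_eq_cvg; near=> delta.
  by rewrite UNE// UE.
Unshelve. all: by end_near. Qed.
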